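(* Let $d\in\mathbb{N}$, let $\Lambda\subset[0,\infty)$ be an additive semigroup with $0\in\Lambda$, and let $\omega$ be an admissible weight on $\Lambda$. A function $f\in\mathcal{D}(\Lambda,\omega,M_d(\mathbb{BC}))$ has an inverse in $\mathcal{D}(\Lambda,\omega,M_d(\mathbb{BC}))$ if and only if $\overline{\{f(s):s\in\mathcal{H}\}}\subset GL_d(\mathbb{BC})$.
   Context: $\mathcal{H}=\{s\in\mathbb C:\operatorname{Re}s\geq 0\}$. $\mathbb{BC}$ (bicomplex numbers) is the 4-dimensional real commutative algebra with elements $x_1+x_2i+x_3j+x_4k$ ($x_m\in\mathbb R$), where $i^2=j^2=-1$, $ij=ji=k$, $k^2=1$. With $\mathbf e_1=(1+k)/2$, $\mathbf e_2=(1-k)/2$, every $M\in M_d(\mathbb{BC})$ ($d\times d$ bicomplex matrices) is uniquely $M=M_1\mathbf e_1+M_2\mathbf e_2$ with $M_1,M_2\in M_d(\mathbb C_i)$, $\mathbb C_i=\{x+iy:x,y\in\mathbb R\}$; addition and multiplication are componentwise in this representation, and the norm is $\|M\|=\|M_1\|_{op}+\|M_2\|_{op}$. $GL_d(\mathbb{BC})$ is the set of invertible elements of $M_d(\mathbb{BC})$. A weight on $\Lambda$ is $\omega:\Lambda\to[1,\infty)$ with $\omega(0)=1$, $\omega(\lambda_1+\lambda_2)\le\omega(\lambda_1)\omega(\lambda_2)$; admissible if $\lim_{n\to\infty}\omega(n\lambda)^{1/n}=1$ for all $\lambda$. For a unital Banach algebra $\mathcal A$ (real or complex), $\mathcal D(\Lambda,\omega,\mathcal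 A)$ is the set of $f:\mathcal H\to\mathcal A$, $f(s)=\sum_{\lambda\in\Lambda}f_\lambda e^{-\lambda s}$ with $\sum_\lambda\|f_\lambda\|\omega(\lambda)<\infty$, a unital Banach algebra under pointwise multiplication. *)

(* Defs.v *)
From HB Require Import structures.
From mathcomp Require Import all_boot all_order all_algebra.
From mathcomp Require Import all_classical all_reals all_analysis.
From mathcomp Require Import complex.

Set Implicit Arguments.
Unset Strict Implicit.
Unset Printing Implicit Defensive.
Import Order.TTheory GRing.Theory Num.Theory numFieldNormedType.Exports.
Local Open Scope classical_set_scope.
Local Open Scope ring_scope.

Section Bicomplex.
Variable R : realType.
Local Notation C := (R[i]).

Definition cabs (z : C) : R :=
  Num.sqrt (complex.Re z ^+ 2 + complex.Im z ^+ 2).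

Definition vnorm2 (n : nat) (v : 'cV[C]_n) : R :=
  Num.sqrt (\sum_(i < n) cabs (v i ord0) ^+ 2).

Definition opnorm (n : nat) (M : 'M[C]_n) : R :=
  sup [set x | exists v : 'cV[C]_n, vnorm2 v = 1 /\ x = vnorm2 (M *m v)].

(* A d x d bicomplex matrix M = M1 e1 + M2 e2, stored as (M1, M2). *)
Record bcmat (n : nat) := BCMat { bc1 : 'M[C]_n ; bc2 : 'M[C]_n }.

Definition bcone n : bcmat n := BCMat 1%:M 1%:M.
Definition bcadd n (M N : bcmat n) : bcmat n :=
  BCMat (bc1 M + bc1 N) (bc2 M + bc2 N).
Definition bcsub n (M N : bcmat n) : bcmat n :=
  BCMat (bc1 M - bc1 N) (bc2 M - bc2 N).
Definition bcmul n (M N : bcmat n) : bcmat n :=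
  BCMat (bc1 M *m bc1 N) (bc2 M *m bc2 N).
(* multiplication by c in C_i (c = c e1 + c e2) *)
Definition bcscale n (c : C) (M : bcmat n) : bcmat n :=
  BCMat (c *: bc1 M) (c *: bc2 M).
Definition bcnorm n (M : bcmat n) : R := opnorm (bc1 M) + opnorm (bc2 M).
Definition bcfsum n (X : set R) (G : R -> bcmat n) : bcmat n :=
  BCMat (\sum_(l \in X) bc1 (G l)) (\sum_(l \in X) bc2 (G l)).

Definition bc_invertible n (M : bcmat n) : Prop :=
  exists N : bcmat n, bcmul M N = bcone n /\ bcmul N M = bcone n.

(* e^{-l s} = e^{-l x} (cos (l y) - i sin (l y)) for s = x + i y *)
Definition cexpn (l : R) (s : C) : C :=
  complex.Complex (expR (- (l * complex.Re s)) * cos (l * complex.Im s))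
  (- (expR (- (l * complex.Re s)) * sin (l * complex.Im s))).

Definition inH (s : C) : Prop := 0 <= complex.Re s.

Definition is_weight (Lam : set R) (w : R -> R) : Prop :=
  [/\ forall l, Lam l -> 1 <= w l,
      w 0 = 1 &
      forall l1 l2, Lam l1 -> Lam l2 -> w (l1 + l2) <= w l1 * w l2].

Definition admissible_weight (Lam : set R) (w : R -> R) : Prop :=
  is_weight Lam w /\
  forall l, Lam l -> (fun k : nat => w (k%:R * l) `^ (k%:R)^-1) @ \oo --> (1 : R).

Definition weighted_summable n (Lam : set R) (w : R -> R) (F : R -> bcmat n) : Prop :=
  (\esum_(l in Lam) ((bcnorm (F l) * w l)%:E) < +oo)%E.

(* v = sum_{l in Lam} F_l e^{-l s}  (unconditional convergence of the net of
   finite partial sums, w.r.t. the norm of M_d(BC)) *)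
Definition has_sum_at n (Lam : set R) (F : R -> bcmat n) (s : C) (v : bcmat n) : Prop :=
  forall e : R, 0 < e -> exists X0 : set R,
    [/\ finite_set X0, X0 `<=` Lam &
      forall X : set R, finite_set X -> X0 `<=` X -> X `<=` Lam ->
        bcnorm (bcsub (bcfsum X (fun l => bcscale (cexpn l s) (F l))) v) < e].

Definition inD n (Lam : set R) (w : R -> R) (f : C -> bcmat n) : Prop :=
  exists F : R -> bcmat n, weighted_summable Lam w F /\
    forall s, inH s -> has_sum_at Lam F s (f s).

Definition invertible_in_D n (Lam : set R) (w : R -> R) (f : C -> bcmat n) : Prop :=
  exists g : C -> bcmat n, inD Lam w g /\
    forall s, inH s -> bcmul (f s) (g s) = bcone n /\ bcmul (g s) (f s) = bcone n.

Definition range_closure_in_GL n (f : C -> bcmat n) : Prop :=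
  forall M : bcmat n,
    (forall e : R, 0 < e -> exists s, inH s /\ bcnorm (bcsub (f s) M) < e) ->
    bc_invertible M.

End Bicomplex.

(* Main.v *)
Require Import Defs.
From HB Require Import structures.
From mathcomp Require Import all_boot all_order all_algebra.
From mathcomp Require Import all_classical all_reals all_analysis.
From mathcomp Require Import complex.
From mathcomp Require Import ring lra.
Import Order.TTheory GRing.Theory Num.Theory numFieldNormedType.Exports.
Local Open Scope classical_set_scope.
Local Open Scope ring_scope.

Set Implicit Arguments.
Unset Strict Implicit.
Unset Printing Implicit Defensive.

(* The determinants of the two idempotent components reduce the claim to scalar
   series: a scalar f with |f| >= delta on Re s >= 0 has an inverse in the
   weighted algebra. Approximate f by a Dirichlet polynomial P and let E be the
   set of its positive exponents. On the monoid generated by E the weight grows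
   slower than any exp (eps * l), so it is enough to invert P, with control of
   the powers of the inverse, in the unweighted algebra of a slightly larger
   half-plane. Mean values bound a coefficient by the sup norm, and the monoid
   is so sparse that sum_l exp (- eta * l) converges; hence the l^1-norm of Q ^+
   k is at most K times the k-th power of the sup norm of Q, with K independent
   of k. This lets Newman's trick push the abscissa of absolute convergence of
   1/P to the left by a fixed step, and finally replace P by f. Working with
   approximate inverses keeps everything inside the Dirichlet polynomials until
   the last step. *)

(** Admissibility bounds [w] only along the multiples of a single exponent, without uniformity over
    [Lam]. Submultiplicativity carries the bound to finitely many generators, and a thin strip to
    the left of the imaginary axis then absorbs it; this forces the detour through polynomials and
    negative abscissas. The constant K of the coefficient bound may be huge, but it multiplies a
    whole power: as in the spectral radius formula only the ratio of the powers matters, and a ratio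
    below 1 is all that a Neumann series asks for. K therefore enters neither the smallness
    condition nor the width of a Newman step, so finitely many equal steps cross any distance. At
    the matrix level, compactness turns the closure condition into a uniform lower bound for each of
    the two determinants. *)

(** * Modulus of complex numbers and of the exponentials *)

Section ComplexModulus.
Variable R : realType.
Local Notation C := (R[i]).
Implicit Types (x y z s : C) (l t : R).

Lemma cabsE z : cabs z = Normc.normc z.
Proof. by case: z. Qed.

Lemma cabs_ge0 z : 0 <= cabs z.
Proof. exact: sqrtr_ge0. Qed.

Lemma cabs0 : cabs (0 : C) = 0.
Proof. by rewrite cabsE Normc.normc0. Qed.

Lemma cabs1 : cabs (1 : C) = 1.
Proof. by rewrite cabsE Normc.normc1. Qed.

Lemma cabs_eq0 z : cabs z = 0 -> z = 0.
Proof. by rewrite cabsE => /Normc.eq0_normc. Qed.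

Lemma cabsM x y : cabs (x * y) = cabs x * cabs y.
Proof. by rewrite !cabsE Normc.normcM. Qed.

Lemma cabsN x : cabs (- x) = cabs x.
Proof. by case: x => a b; rewrite /cabs /= !sqrrN. Qed.

Lemma cabsV x : cabs x^-1 = (cabs x)^-1.
Proof. by rewrite !cabsE Normc.normcV. Qed.

Lemma cabsD x y : cabs (x + y) <= cabs x + cabs y.
Proof. by rewrite !cabsE; exact: le_normcD. Qed.

Lemma cabsB x y : cabs (x - y) <= cabs x + cabs y.
Proof. by rewrite -(cabsN y) cabsD. Qed.

Lemma cabs_dist_triangle x y z : cabs (x - z) <= cabs (x - y) + cabs (y - z).
Proof. by rewrite -[x in leLHS](subrK y x) -addrA cabsD. Qed.

Lemma cabs_sum (I : Type) (r : seq I) (P : pred I) (F : I -> C) :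
  cabs (\sum_(i <- r | P i) F i) <= \sum_(i <- r | P i) cabs (F i).
Proof.
apply: (big_ind2 (fun z t => cabs z <= t)); first by rewrite cabs0.
  by move=> x1 t1 x2 t2 h1 h2; apply: le_trans (cabsD _ _) _; exact: lerD.
by [].
Qed.

Lemma cabsX x n : cabs (x ^+ n) = cabs x ^+ n.
Proof. by elim: n => [|n IH]; rewrite ?cabs1 // !exprS cabsM IH. Qed.

Lemma cabsR t : 0 <= t -> cabs (t%:C)%C = t.
Proof. by move=> t0; rewrite /cabs /= expr0n addr0 sqrtr_sqr ger0_norm. Qed.

Lemma normRe_le_cabs z : `|complex.Re z| <= cabs z.
Proof. by rewrite /cabs -sqrtr_sqr ler_wsqrtr// lerDl sqr_ge0. Qed.

Lemma normIm_le_cabs z : `|complex.Im z| <= cabs z.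
Proof. by rewrite /cabs -sqrtr_sqr ler_wsqrtr// lerDr sqr_ge0. Qed.

Lemma cabs_le_ReIm z : cabs z <= `|complex.Re z| + `|complex.Im z|.
Proof.
rewrite -[leRHS]ger0_norm ?addr_ge0// -sqrtr_sqr ler_wsqrtr//.
by rewrite sqrrD !real_normK ?num_real// addrAC lerDl mulrn_wge0 // mulr_ge0.
Qed.

Lemma cexpnD l (s t : C) : cexpn l (s + t) = cexpn l s * cexpn l t :> C.
Proof.
case: s => a b; case: t => c e; rewrite /cexpn /=.
rewrite !mulrDr opprD expRD cosD sinD.
by apply/eqP; rewrite eq_complex /=; apply/andP; split; apply/eqP; ring.
Qed.

Lemma cexpn_addl (l1 l2 : R) s : cexpn (l1 + l2) s = cexpn l1 s * cexpn l2 s :> C.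
Proof.
case: s => a b; rewrite /cexpn /=.
rewrite !mulrDl opprD expRD cosD sinD.
by apply/eqP; rewrite eq_complex /=; apply/andP; split; apply/eqP; ring.
Qed.

Lemma cexpn0 s : cexpn 0 s = 1 :> C.
Proof. by rewrite /cexpn !mul0r oppr0 expR0 cos0 sin0 !mulr0 mulr1 oppr0. Qed.

Lemma cabs_cexpn l s : cabs (cexpn l s) = expR (- (l * complex.Re s)).
Proof.
rewrite /cabs /cexpn /= sqrrN !exprMn -mulrDr cos2Dsin2 mulr1 sqrtr_sqr.
by rewrite ger0_norm// expR_ge0.
Qed.

Lemma cexpn_real l t : cexpn l (t%:C)%C = ((expR (- (l * t)))%:C)%C.
Proof. by rewrite /cexpn /= mulr0 cos0 sin0 mulr0 mulr1 oppr0. Qed.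

End ComplexModulus.

(** * Dirichlet polynomials and their weighted norms *)

Section DirichletPolynomials.
Variable R : realType.
Local Notation C := (R[i]).

Definition dpoly (L : seq (R * C)) (s : C) : C :=
  \sum_(p <- L) p.2 * cexpn p.1 s.

(* A norm bound rather than a norm: [L] may repeat exponents, so [x] only bounds
   the weighted l^1-norm of [g], and sums and products need no regrouping. *)
Definition dpnorm (S : set R) (v : R -> R) (g : C -> C) (x : R) : Prop :=
  exists L, [/\ forall p, p \in L -> S p.1, forall s, g s = dpoly L s &
                \sum_(p <- L) cabs p.2 * v p.1 <= x].

Definition submonoid (S : set R) : Prop :=
  [/\ S 0, (forall a b, S a -> S b -> S (a + b)) & forall a, S a -> 0 <= a].

Definition submult (S : set R) (v : R -> R) : Prop :=
  [/\ v 0 = 1, (forall a, S a -> 0 <= v a) &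
      forall a b, S a -> S b -> v (a + b) <= v a * v b].

(* The weight whose l^1-norm controls absolute convergence on Re s >= sig. *)
Definition wexp (sig : R) (l : R) : R := expR (- (l * sig)).

Lemma submult_wexp S sig : submult S (wexp sig).
Proof.
split; rewrite /wexp; first by rewrite mul0r oppr0 expR0.
  by move=> a _; exact: expR_ge0.
by move=> a b _ _; rewrite mulrDl opprD expRD.
Qed.

Lemma dpoly_cat L1 L2 s : dpoly (L1 ++ L2) s = dpoly L1 s + dpoly L2 s.
Proof. by rewrite /dpoly big_cat. Qed.

Section Norm.
Variables (S : set R) (v : R -> R).

Lemma dpnorm_ext g h x : (forall s, g s = h s) -> dpnorm S v g x -> dpnorm S v h x.
Proof. by move=> e [L [a b c]]; exists L; split => // s; rewrite -e. Qed.

Lemma dpnorm_weaken g x y : x <= y -> dpnorm S v g x -> dpnorm S v g y.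
Proof. by move=> e [L [a b c]]; exists L; split => //; exact: le_trans e. Qed.

Lemma dpnorm0 x : 0 <= x -> dpnorm S v (fun=> 0) x.
Proof.
move=> x0; exists [::]; split => //; first by move=> s; rewrite /dpoly big_nil.
by rewrite big_nil.
Qed.

Lemma dpnormD g h x y : dpnorm S v g x -> dpnorm S v h y ->
  dpnorm S v (fun s => g s + h s) (x + y).
Proof.
move=> [L [a b c]] [L' [a' b' c']]; exists (L ++ L'); split.
- by move=> p; rewrite mem_cat => /orP[/a|/a'].
- by move=> s; rewrite b b' dpoly_cat.
- by rewrite big_cat lerD.
Qed.

Lemma dpnormN g x : dpnorm S v g x -> dpnorm S v (fun s => - g s) x.
Proof.
move=> [L [a b c]]; exists [seq (p.1, - p.2) | p <- L]; split.
- by move=> p /mapP[q /a qS ->].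
- move=> s; rewrite b /dpoly big_map -sumrN.
  by apply: eq_bigr => p _; rewrite mulNr.
- by rewrite big_map (eq_bigr (fun p => cabs p.2 * v p.1)) // => p _ /=; rewrite cabsN.
Qed.

Lemma dpnormB g h x y : dpnorm S v g x -> dpnorm S v h y ->
  dpnorm S v (fun s => g s - h s) (x + y).
Proof. by move=> gx hy; apply: dpnormD => //; exact: dpnormN. Qed.

Lemma dpnorm_ge0 g x : (forall a, S a -> 0 <= v a) -> dpnorm S v g x -> 0 <= x.
Proof.
move=> v0 [L [a b c]]; apply: le_trans c; rewrite big_seq sumr_ge0// => p pL.
by rewrite mulr_ge0 ?cabs_ge0 ?v0//; exact: a.
Qed.

Lemma dpnorm_eval g x s : (forall l, S l -> wexp (complex.Re s) l <= v l) ->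
  dpnorm S v g x -> cabs (g s) <= x.
Proof.
move=> sv [L [a b c]]; rewrite b; apply: le_trans c.
apply: le_trans (cabs_sum _ _ _) _.
rewrite big_seq [leRHS]big_seq; apply: ler_sum => p pL.
by rewrite cabsM cabs_cexpn ler_wpM2l ?cabs_ge0//; apply: sv; exact: a.
Qed.

Hypothesis Sv : submult S v.
Hypothesis Smon : submonoid S.

Lemma dpnorm_cst c : dpnorm S v (fun=> c) (cabs c).
Proof.
case: Smon => S0 _ _; case: Sv => v0 _ _; exists [:: (0, c)]; split.
- by move=> p; rewrite inE => /eqP->.
- by move=> s; rewrite /dpoly big_seq1 cexpn0 mulr1.
- by rewrite big_seq1 v0 mulr1.
Qed.

Lemma dpnormM g h x y : dpnorm S v g x -> dpnorm S v h y ->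
  dpnorm S v (fun s => g s * h s) (x * y).
Proof.
case: Smon => _ SD _; case: Sv => _ v0 vM.
move=> [L [a b c]] [L' [a' b' c']].
exists [seq (p.1 + q.1, p.2 * q.2) | p <- L, q <- L']; split.
- by move=> p /allpairsP[[q r] /= [/a qS /a' rS ->]]; exact: SD.
- move=> s; rewrite b b' /dpoly big_allpairs_dep big_distrl /=.
  apply: eq_bigr => p _; rewrite big_distrr /=; apply: eq_bigr => q _.
  by rewrite cexpn_addl; ring.
- rewrite big_allpairs_dep /=.
  apply: le_trans (ler_pM _ _ c c'); last 2 first.
  + by rewrite big_seq sumr_ge0// => p pL; rewrite mulr_ge0 ?cabs_ge0 ?v0//; exact: a.
  + by rewrite big_seq sumr_ge0// => p pL; rewrite mulr_ge0 ?cabs_ge0 ?v0//; exact: a'.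
  rewrite big_distrl /= big_seq [leRHS]big_seq; apply: ler_sum => p pL.
  rewrite big_distrr /= big_seq [leRHS]big_seq; apply: ler_sum => q qL.
  rewrite cabsM mulrACA ler_wpM2l ?mulr_ge0 ?cabs_ge0//.
  by apply: vM; [exact: a|exact: a'].
Qed.

Lemma dpnormX g x n : dpnorm S v g x -> dpnorm S v (fun s => g s ^+ n) (x ^+ n).
Proof.
move=> gx; elim: n => [|n IH].
  by rewrite expr0 -cabs1; apply: dpnorm_ext (dpnorm_cst _) => s; rewrite expr0.
by rewrite exprS; apply: dpnorm_ext (dpnormM gx IH) => s; rewrite exprS.
Qed.

Lemma dpnorm_sum (I : Type) (r : seq I) (g : I -> C -> C) (x : I -> R) :
  (forall i, dpnorm S v (g i) (x i)) ->
  dpnorm S v (fun s => \sum_(i <- r) g i s) (\sum_(i <- r) x i).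
Proof.
move=> gx; elim: r => [|i r IH].
  rewrite big_nil; apply: dpnorm_ext (dpnorm0 (lexx 0)) => s; by rewrite big_nil.
rewrite big_cons; apply: dpnorm_ext (dpnormD (gx i) IH) => s; by rewrite big_cons.
Qed.

End Norm.

(** Serves to pass from exponential weights on a finitely generated monoid to [w] on [Lam], at the
    price of a factor K. *)
Lemma dpnorm_mono (S S' : set R) (v v' : R -> R) (K : R) g x : S `<=` S' ->
  0 <= K -> (forall l, S l -> v' l <= K * v l) ->
  dpnorm S v g x -> dpnorm S' v' g (K * x).
Proof.
move=> SS' K0 vv' [L [a b c]]; exists L; split => //; first by move=> p /a /SS'.
apply: le_trans (ler_wpM2l K0 c); rewrite big_distrr /=.
rewrite big_seq [leRHS]big_seq; apply: ler_sum => p pL.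
by rewrite mulrCA ler_wpM2l ?cabs_ge0// vv'//; exact: a.
Qed.

Lemma dpnorm_wexp_mono (S : set R) (sig sig' : R) g x : submonoid S ->
  sig <= sig' -> dpnorm S (wexp sig) g x -> dpnorm S (wexp sig') g x.
Proof.
move=> [_ _ S0] ss gx; rewrite -[x]mul1r; apply: dpnorm_mono gx => // l Sl.
by rewrite mul1r /wexp ler_expR lerN2 ler_wpM2l// S0.
Qed.

Lemma dpnorm_eval_wexp (S : set R) (sig : R) g x s : submonoid S ->
  sig <= complex.Re s -> dpnorm S (wexp sig) g x -> cabs (g s) <= x.
Proof.
move=> [_ _ S0] ss; apply: dpnorm_eval => l Sl.
by rewrite /wexp ler_expR lerN2 ler_wpM2l// S0.
Qed.

(** Translation by tau multiplies the coefficient at l by e^(-l tau), exactly the ratio of the two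
    weights, so a translate gains tau at no cost in norm. *)
Lemma dpnorm_shift (S : set R) (sig tau : R) g x :
  dpnorm S (wexp sig) g x ->
  dpnorm S (wexp (sig - tau)) (fun s => g (s + (tau%:C)%C)) x.
Proof.
move=> [L [a b c]].
exists [seq (p.1, p.2 * cexpn p.1 (tau%:C)%C) | p <- L]; split.
- by move=> p /mapP[q /a qS ->].
- move=> s; rewrite b /dpoly big_map; apply: eq_bigr => p _ /=.
  by rewrite cexpnD; ring.
- rewrite big_map (eq_bigr (fun p => cabs p.2 * wexp sig p.1)) // => p _ /=.
  by rewrite cabsM cabs_cexpn /wexp -mulrA -expRD /=; congr (_ * expR _); ring.
Qed.

End DirichletPolynomials.

Lemma ler_sum_subset (R : numDomainType) (T : eqType) (s t : seq T) (F : T -> R) :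
  uniq s -> {subset s <= t} -> (forall x, 0 <= F x) ->
  \sum_(x <- s) F x <= \sum_(x <- t) F x.
Proof.
move=> us st F0; elim: s t us st => [|x s IH] t; first by rewrite big_nil sumr_ge0.
move=> /= /andP[xs us] st; rewrite big_cons [leRHS](big_rem x) ?st ?mem_head//= lerD2l.
apply: IH => // y ys; have /st : y \in x :: s by rewrite inE ys orbT.
have [yx|yx] := eqVneq y x; first by rewrite -yx ys in xs.
by rewrite (perm_mem (perm_to_rem (st x (mem_head _ _)))) inE (negPf yx).
Qed.

(** * Mean values and the passage from sup norm to weighted norm *)

Section CoefficientBound.
Variable R : realType.
Local Notation C := (R[i]).

(* Averaging the function with its translate by [i pi / mu] kills the frequency
   [mu] and preserves both the constant term and the bound. *)
Lemma constant_term_bound (a : C) (B : R) (L : seq (R * C)) :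
  (forall p, p \in L -> p.1 != 0) ->
  (forall t : R, cabs (a + dpoly L (Complex 0 t)) <= B) -> cabs a <= B.
Proof.
have [n] := ubnP (size L); elim: n L => // n IH [|p L] sL L0 LB.
  by have := LB 0; rewrite /dpoly big_nil addr0.
have p0 : p.1 != 0 by apply: L0; rewrite mem_head.
pose tau : C := Complex 0 (pi / p.1).
apply: (IH [seq (q.1, q.2 * (1 + cexpn q.1 tau) / 2) | q <- L]).
- by rewrite size_map.
- by move=> q /mapP[r rL ->] /=; apply: L0; rewrite inE rL orbT.
move=> t.
set z := (X in cabs X <= _).
have -> : z = (2^-1%:C)%C * ((a + dpoly (p :: L) (Complex 0 t)) +
                  (a + dpoly (p :: L) (Complex 0 (t + pi / p.1)))).
  have -> : Complex 0 (t + pi / p.1) = Complex 0 t + tau.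
    by rewrite /tau; apply/eqP; rewrite eq_complex /= addr0 !eqxx.
  have ep : cexpn p.1 tau = -1.
    rewrite /cexpn /tau /= mulr0 oppr0 expR0 !mul1r mulrCA divff// mulr1 cospi sinpi.
    by rewrite oppr0; apply/eqP; rewrite eq_complex /= oppr0 !eqxx.
  have -> : ((2^-1 : R)%:C)%C = (2^-1 : C) by rewrite fmorphV rmorph_nat.
  rewrite /z /dpoly !big_cons big_map /= cexpnD ep.
  transitivity (a + 2^-1 * (\sum_(j <- L) j.2 * cexpn j.1 (Complex 0 t) +
                        \sum_(j <- L) j.2 * cexpn j.1 (Complex 0 t + tau))).
    congr (_ + _); rewrite -big_split big_distrr; apply: eq_bigr => j _ /=.
    by rewrite cexpnD; ring.
  by field.
rewrite cabsM cabsR ?invr_ge0// mulrC ler_pdivrMr// mulr_natr mulr2n.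
by apply: le_trans (cabsD _ _) _; exact: lerD.
Qed.

Definition coef (L : seq (R * C)) (l : R) : C := \sum_(p <- L | p.1 == l) p.2.

(** Division by e^(-l s) on the line Re s = sig turns the coefficient at l into a constant term. The
    shifted exponents p.1 - l may be negative, which [constant_term_bound] allows. *)
Lemma coef_bound L l sig B :
  (forall s, complex.Re s = sig -> cabs (dpoly L s) <= B) ->
  cabs (coef L l) * wexp sig l <= B.
Proof.
move=> LB; pose s0 : C := Complex sig 0.
have -> : cabs (coef L l) * wexp sig l = cabs (coef L l * cexpn l s0).
  by rewrite cabsM cabs_cexpn.
apply: (@constant_term_bound _ _
  [seq (p.1 - l, p.2 * cexpn p.1 s0) | p <- L & p.1 != l]).
  by move=> p /mapP[q]; rewrite mem_filter => /andP[ql _] -> /=; rewrite subr_eq0.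
move=> t; have /LB : complex.Re (Complex sig t) = sig by [].
apply: le_trans.
rewrite -[leRHS]mulr1.
have <- : cabs (cexpn (- l) (Complex 0 t)) = 1.
  by rewrite cabs_cexpn /= mulr0 oppr0 expR0.
rewrite -cabsM le_eqVlt; apply/orP; left; apply/eqP; congr cabs.
have -> : Complex sig t = s0 + Complex 0 t.
  by rewrite /s0; apply/eqP; rewrite eq_complex /= addr0 add0r !eqxx.
rewrite /dpoly big_map big_filter /coef big_distrl big_distrl /=.
rewrite [RHS](bigID (fun p : R * C => p.1 == l)) /=.
congr (_ + _); apply: eq_bigr => p.
  move=> /eqP ->; rewrite cexpnD -!mulrA -cexpn_addl subrr.
  by rewrite cexpn0 mulr1.
by move=> _; rewrite cexpnD cexpn_addl; ring.
Qed.

Lemma coef_out L l : l \notin [seq p.1 | p <- L] -> coef L l = 0.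
Proof.
move=> lL; rewrite /coef big1_seq// => p /andP[/eqP pl pL].
by case/negP: lL; rewrite -pl map_f.
Qed.

Lemma coef_cat L1 L2 l : coef (L1 ++ L2) l = coef L1 l + coef L2 l.
Proof. by rewrite /coef big_cat. Qed.

Lemma sum_by_exponent (V : zmodType) (L : seq (R * C)) (X : seq R) (F : R * C -> V) :
  uniq X -> 
  \sum_(l <- X) \sum_(p <- L | p.1 == l) F p = \sum_(p <- L | p.1 \in X) F p.
Proof.
move=> uX; under eq_bigr do rewrite big_mkcond.
rewrite exchange_big [RHS]big_mkcond /=; apply: eq_bigr => p _.
rewrite -big_mkcond /=; case: ifP => pX.
  under eq_bigl do rewrite eq_sym.
  by rewrite -big_filter (filter_pred1_uniq uX pX) big_seq1.
by rewrite big1_seq// => l /andP[/eqP lp]; rewrite -lp pX.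
Qed.

Lemma dpoly_coef L X s : uniq X -> (forall p, p \in L -> p.1 \in X) ->
  dpoly L s = \sum_(l <- X) coef L l * cexpn l s.
Proof.
move=> uX LX; rewrite /dpoly.
rewrite [RHS](eq_bigr (fun l => \sum_(p <- L | p.1 == l) p.2 * cexpn p.1 s)); last first.
  by move=> l _; rewrite /coef big_distrl; apply: eq_bigr => p /eqP ->.
rewrite (sum_by_exponent L (fun p => p.2 * cexpn p.1 s))//.
by rewrite [RHS]big_mkcond big_seq [RHS]big_seq; apply: eq_bigr => p /LX ->.
Qed.

(** Grouping equal exponents only lowers the norm, by the triangle inequality. *)
Lemma sum_coef_le (S : set R) (v : R -> R) L X : (forall a, S a -> 0 <= v a) ->
  (forall p, p \in L -> S p.1) -> uniq X ->
  \sum_(l <- X) cabs (coef L l) * v l <= \sum_(p <- L) cabs p.2 * v p.1.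
Proof.
move=> v0 LS uX.
apply: (@le_trans _ _ (\sum_(l <- X) \sum_(p <- L | p.1 == l) cabs p.2 * v p.1)).
  apply: ler_sum => l _.
  have [lL|lL] := boolP (l \in [seq p.1 | p <- L]); last first.
    rewrite coef_out// cabs0 mul0r big1_seq// => p /andP[/eqP pl pL].
    by case/negP: lL; rewrite -pl map_f.
  have vl : 0 <= v l by move/mapP: lL => [p /LS pS ->]; exact: v0.
  rewrite (eq_bigr (fun p => cabs p.2 * v l)); last by move=> p /eqP ->.
  by rewrite -big_distrl /= ler_wpM2r// cabs_sum.
rewrite (sum_by_exponent L (fun p => cabs p.2 * v p.1))// big_mkcond /=.
rewrite big_seq [leRHS]big_seq; apply: ler_sum => p pL; case: ifP => // _.
by rewrite mulr_ge0 ?cabs_ge0 ?v0//; exact: LS.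
Qed.

Definition exp_summable (S : set R) (eta K : R) : Prop :=
  forall X, uniq X -> (forall l, l \in X -> S l) -> \sum_(l <- X) wexp eta l <= K.

(** Each coefficient is at most B e^(l sig), and the factor e^(-l eta) makes these bounds summable.
    K depends on S and eta alone, hence serves all powers of a function at once. *)
Lemma dpnorm_sup (S : set R) v (g : C -> C) x sig eta K B :
  exp_summable S eta K -> dpnorm S v g x -> 0 <= B ->
  (forall s, complex.Re s = sig -> cabs (g s) <= B) ->
  dpnorm S (wexp (sig + eta)) g (K * B).
Proof.
move=> SK [L [LS gL _]] B0 gB.
pose X := undup [seq p.1 | p <- L].
have uX : uniq X by exact: undup_uniq.
exists [seq (l, coef L l) | l <- X]; split.
- by move=> p /mapP[l]; rewrite mem_undup => /mapP[q qL ->] -> /=; exact: LS.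
- move=> s; rewrite gL /dpoly big_map -dpoly_coef// => p pL.
  by rewrite mem_undup map_f.
- rewrite big_map /=; apply: (@le_trans _ _ (\sum_(l <- X) wexp eta l * B)).
    apply: ler_sum => l _; rewrite /wexp mulrDr opprD expRD mulrA mulrC.
    rewrite ler_wpM2l ?expR_ge0//; apply: coef_bound => s; rewrite -gL; exact: gB.
  rewrite -big_distrl /= ler_wpM2r//; apply: SK => // l.
  by rewrite mem_undup => /mapP[q qL ->]; exact: LS.
Qed.

End CoefficientBound.

(** * Finitely generated monoids of exponents *)

Section FinitelyGenerated.
Variable R : realType.
Implicit Types (E : seq R) (l : R).

(** Multiplicities are capped at M, so that the combinations form a finite box over which
    exponential sums factor; repeated values are harmless in an upper bound. *)
Fixpoint combs (M : nat) E : seq R :=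
  if E is a :: E' then [seq k%:R * a + l | k <- iota 0 M.+1, l <- combs M E']
  else [:: 0].

Definition gen E : set R := [set l | exists M, l \in combs M E].

Lemma combsE M a E :
  combs M (a :: E) = [seq k%:R * a + l | k <- iota 0 M.+1, l <- combs M E].
Proof. by []. Qed.

Lemma mem_combs M a E l : reflect (exists k l', [/\ (k <= M)%N, l' \in combs M E &
  l = k%:R * a + l']) (l \in combs M (a :: E)).
Proof.
apply: (iffP allpairsP) => [[[k l'] /= [kM l'E ->]]|[k [l' [kM l'E ->]]]].
  by exists k, l'; split => //; have := kM : k \in iota 0 M.+1; rewrite mem_iota.
by exists (k, l'); split => //; rewrite -/(iota 0 M.+1) mem_iota.
Qed.

Lemma combsS M M' E l : (M <= M')%N -> l \in combs M E -> l \in combs M' E.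
Proof.
move=> MM'; elim: E l => // a E IH l /mem_combs[k [l' [kM /IH l'E ->]]].
by apply/mem_combs; exists k, l'; split => //; exact: leq_trans MM'.
Qed.

Lemma combsD M M' E l l' : l \in combs M E -> l' \in combs M' E ->
  l + l' \in combs (M + M') E.
Proof.
elim: E l l' => [l l'|a E IH l l'].
  by rewrite !inE => /eqP -> /eqP ->; rewrite addr0.
move=> /mem_combs[k [m [kM mE ->]]] /mem_combs[k' [m' [kM' mE' ->]]].
apply/mem_combs; exists (k + k')%N, (m + m'); split; [exact: leq_add|exact: IH|].
by rewrite natrD; ring.
Qed.

Lemma combs0 E : 0 \in combs 0 E.
Proof.
elim: E => [|a E IH]; first by rewrite inE.
by apply/mem_combs; exists 0%N, 0; rewrite mul0r addr0.
Qed.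

Lemma gen_cons a E l : gen (a :: E) l ->
  exists k l', gen E l' /\ l = k%:R * a + l'.
Proof. by move=> [M /mem_combs[k [l' [_ l'E ->]]]]; exists k, l'; split => //; exists M. Qed.

Lemma submonoid_gen E : (forall a, a \in E -> 0 <= a) -> submonoid (gen E).
Proof.
move=> E0; split; first by exists 0%N; exact: combs0.
  by move=> a b [M aM] [M' bM']; exists (M + M')%N; exact: combsD.
elim: E E0 => [|a E IH] E0 l; first by move=> [M]; rewrite inE => /eqP ->.
move=> /gen_cons[k [l' [/IH l'0 ->]]]; rewrite addr_ge0// ?mulr_ge0//.
  by apply: E0; rewrite mem_head.
by apply: l'0 => b bE; apply: E0; rewrite inE bE orbT.
Qed.

Lemma mem_gen E a : a \in E -> gen E a.
Proof.
move=> aE; exists 1%N; elim: E aE => // b E IH; rewrite inE => /orP[/eqP ->|/IH aE].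
  by apply/mem_combs; exists 1%N, 0; rewrite mul1r addr0; split => //; exact: combsS (combs0 E).
by apply/mem_combs; exists 0%N, a; rewrite mul0r add0r.
Qed.

Lemma gen_sub (S : set R) E : submonoid S -> (forall a, a \in E -> S a) -> gen E `<=` S.
Proof.
move=> [S0 SD _]; elim: E => [|a E IH] ES l; first by move=> [M]; rewrite inE => /eqP ->.
move=> /gen_cons[k [l' [l'E ->]]]; apply: (SD); last first.
  by apply: IH => // b bE; apply: ES; rewrite inE bE orbT.
elim: k => [|k IHk]; first by rewrite mul0r.
by rewrite -natr1 mulrDl mul1r; apply: SD => //; apply: ES; rewrite mem_head.
Qed.

Lemma sum_geometric_le (q : R) n : 0 <= q -> q < 1 -> \sum_(k <- iota 0 n) q ^+ k <= (1 - q)^-1.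
Proof.
move=> q0 q1; have q1' : 0 < 1 - q by rewrite subr_gt0.
rewrite -[leRHS]mul1r ler_pdivlMr//.
have -> : (\sum_(k <- iota 0 n) q ^+ k) * (1 - q) = 1 - q ^+ n.
  rewrite mulrC -opprB mulNr -[RHS]opprB subrX1; congr (- (_ * _)).
  by rewrite -[X in iota 0 X]subn0 -/(index_iota 0 n) big_mkord.
by rewrite lerBlDr lerDl exprn_ge0.
Qed.

(** An Euler product: each factor sums the geometric series over the multiples of one generator. *)
Definition gen_const E (eta : R) : R := \prod_(a <- E) (1 - expR (- (a * eta)))^-1.

Lemma gen_const_ge0 E eta : 0 <= eta -> (forall a, a \in E -> 0 < a) ->
  0 <= gen_const E eta.
Proof.
move=> eta0 E0; rewrite /gen_const big_seq prodr_ge0// => a /E0 a0.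
by rewrite invr_ge0 subr_ge0 expR_le1 oppr_le0 mulr_ge0// ltW.
Qed.

(** A finite part of the monoid lies in one box [combs M E], where the sum is a product of truncated
    geometric sums. *)
Lemma gen_exp_summable E eta : 0 < eta -> (forall a, a \in E -> 0 < a) ->
  exp_summable (gen E) eta (gen_const E eta).
Proof.
move=> eta0 E0 X uX XE.
have [M XM] : exists M, forall l, l \in X -> l \in combs M E.
  elim: X XE {uX} => [|l X IH] XE; first by exists 0%N.
  have [|M XM] := IH; first by move=> x xX; apply: XE; rewrite inE xX orbT.
  have [M' lM'] := XE l (mem_head _ _).
  exists (M + M')%N => x; rewrite inE => /orP[/eqP->|/XM xM].
    exact: combsS (leq_addl _ _) lM'.
  exact: combsS (leq_addr _ _) xM.
apply: (@le_trans _ _ (\sum_(l <- combs M E) wexp eta l)).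
  by apply: ler_sum_subset => // l; exact: expR_ge0.
elim: E E0 {XE XM} => [|a E IH] E0.
  by rewrite /gen_const big_nil big_seq1 /wexp mul0r oppr0 expR0.
rewrite /gen_const big_cons combsE big_allpairs_dep.
rewrite (eq_bigr (fun k : nat => expR (- (a * eta)) ^+ k * \sum_(l <- combs M E) wexp eta l)).
  have a0 : 0 < a by apply: E0; rewrite mem_head.
  rewrite -mulr_suml; apply: ler_pM.
  - by rewrite sumr_ge0// => k _; rewrite exprn_ge0 ?expR_ge0.
  - by rewrite sumr_ge0// => k _; rewrite expR_ge0.
  - apply: sum_geometric_le; first exact: expR_ge0.
    by rewrite expR_lt1 oppr_lt0 mulr_gt0.
  - by apply: IH => b bE; apply: E0; rewrite inE bE orbT.
move=> k _; rewrite big_distrr; apply: eq_bigr => l _ /=.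
by rewrite /wexp -expRM_natl -expRD; congr expR; ring.
Qed.

End FinitelyGenerated.

(** * Neumann series, Newman's trick and the descent to the left *)

Section ApproximateInverse.
Variable R : realType.
Local Notation C := (R[i]).
Implicit Types (S : set R) (v : R -> R) (P Q : C -> C).

(** Used with f small in norm and g small only through its powers: the expansion keeps the powers of
    g together, so K is paid once whatever k is. *)
Lemma dpnorm_addX S v (f g : C -> C) e q K : submult S v -> submonoid S ->
  dpnorm S v f e -> (forall k, dpnorm S v (fun s => g s ^+ k) (K * q ^+ k)) ->
  forall k, dpnorm S v (fun s => (f s + g s) ^+ k) (K * (e + q) ^+ k).
Proof.
move=> vS mS fe gq k.
(* The spare factor [g s ^+ j] gathers the powers of [g] during the induction. *)
suff H j : dpnorm S v (fun s => (f s + g s) ^+ k * g s ^+ j) (K * q ^+ j * (e + q) ^+ k).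
  have := H 0%N; rewrite expr0 mulr1; apply: dpnorm_ext => s.
  by rewrite expr0 mulr1.
elim: k j => [|k IH] j.
  by rewrite expr0 mulr1; apply: dpnorm_ext (gq j) => s; rewrite expr0 mul1r.
have H := dpnormD (dpnormM vS mS fe (IH j)) (IH j.+1).
have -> : K * q ^+ j * (e + q) ^+ k.+1 =
  e * (K * q ^+ j * (e + q) ^+ k) + K * q ^+ j.+1 * (e + q) ^+ k.
  by rewrite !exprS; ring.
by apply: dpnorm_ext H => s; rewrite !exprS; ring.
Qed.

Definition neumann P Q n (s : C) : C := Q s * \sum_(k <- iota 0 n) (1 - P s * Q s) ^+ k.

(** The geometric sum telescopes: the defect of the truncation is the n-th power of the defect of
    Q. *)
Lemma neumannE P Q n s : 1 - P s * neumann P Q n s = (1 - P s * Q s) ^+ n.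
Proof.
rewrite /neumann mulrA; set y := P s * Q s.
rewrite -[X in iota 0 X]subn0 -/(index_iota 0 n) big_mkord.
have := subrX1 (1 - y) n; set t := \sum_(i < n) _ => h.
have -> : (1 - y) ^+ n = (1 - y) ^+ n - 1 + 1 by rewrite subrK.
by rewrite h; ring.
Qed.

Lemma dpnorm_neumann S v P Q x K th n : submult S v -> submonoid S ->
  dpnorm S v Q x -> (forall k, dpnorm S v (fun s => (1 - P s * Q s) ^+ k) (K * th ^+ k)) ->
  0 <= K -> 0 <= th -> th < 1 ->
  dpnorm S v (neumann P Q n) (x * (K * (1 - th)^-1)).
Proof.
move=> vS mS Qx Hk K0 th0 th1; apply: dpnormM => //.
apply: dpnorm_weaken (dpnorm_sum _ Hk).
by rewrite -mulr_sumr ler_wpM2l// sum_geometric_le.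
Qed.

Lemma geometric_small (K th e : R) : 0 <= th -> th < 1 -> 0 < e ->
  exists n, forall m, (n <= m)%N -> K * th ^+ m <= e.
Proof.
move=> th0 th1 e0.
have : (fun m => K * th ^+ m) @ \oo --> (K * 0).
  by apply: cvgMr; apply: cvg_expr; rewrite ger0_norm.
rewrite mulr0 => /cvgrPdist_le /(_ e e0) [n _ nh]; exists n => m nm.
have := nh m nm; rewrite sub0r normrN; exact: le_trans (ler_norm _).
Qed.

(* The functions [P] that have an inverse in the completion of the Dirichlet
   polynomials for the [v]-weighted norm, expressed within the polynomials. *)
Definition approx_inv S v P : Prop := forall e : R, 0 < e ->
  exists Q x, dpnorm S v Q x /\ dpnorm S v (fun s => 1 - P s * Q s) e.

Lemma approx_inv_neumann S v P Q x K th : submult S v -> submonoid S ->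
  dpnorm S v Q x -> (forall k, dpnorm S v (fun s => (1 - P s * Q s) ^+ k) (K * th ^+ k)) ->
  0 <= K -> 0 <= th -> th < 1 -> approx_inv S v P.
Proof.
move=> vS mS Qx Hk K0 th0 th1 e e0.
have [n nh] := geometric_small K th0 th1 e0.
exists (neumann P Q n), (x * (K * (1 - th)^-1)); split.
  exact: dpnorm_neumann.
apply: dpnorm_weaken (nh n (leqnn _)) _.
by apply: dpnorm_ext (Hk n) => s; rewrite neumannE.
Qed.

(* The norms of the powers of [Q] grow no faster than the powers of the sup
   norm of [1 / P]: the spectral radius is seen in the sup norm only. *)
Lemma dpnorm_inverse_powers S P Q x e delta sig eta K : submonoid S ->
  exp_summable S eta K -> dpnorm S (wexp sig) Q x ->
  dpnorm S (wexp sig) (fun s => 1 - P s * Q s) e -> 0 < delta ->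
  (forall s, complex.Re s = sig -> delta <= cabs (P s)) ->
  forall k, dpnorm S (wexp (sig + eta)) (fun s => Q s ^+ k) (K * ((1 + e) / delta) ^+ k).
Proof.
move=> mS SK Qx Qe d0 Pd k.
have e0 : 0 <= e by apply: dpnorm_ge0 Qe => a _; exact: expR_ge0.
apply: (dpnorm_sup SK (dpnormX (submult_wexp S sig) mS k Qx)).
  by rewrite exprn_ge0// divr_ge0 ?addr_ge0// ltW.
move=> s sR; rewrite cabsX; apply: lerXn2r;
  rewrite ?nnegrE ?cabs_ge0 ?divr_ge0 ?addr_ge0 ?(ltW d0)//.
rewrite ler_pdivlMr//; apply: (@le_trans _ _ (cabs (Q s) * cabs (P s))).
  by rewrite ler_wpM2l ?cabs_ge0 ?Pd.
have -> : cabs (Q s) * cabs (P s) = cabs (1 - (1 - P s * Q s)).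
  by rewrite -cabsM opprB addrCA subrr addr0 mulrC.
apply: le_trans (cabsB _ _) _; rewrite cabs1 lerD2l.
by apply: (dpnorm_eval_wexp mS _ Qe); rewrite sR.
Qed.

(* Newman's trick: the inverse on Re s >= sig, after losing eta by
   [dpnorm_inverse_powers], is perturbed to one for the translate of P by 2 eta. *)
Lemma approx_inv_step S P sig eta K rho delta : submonoid S ->
  0 <= K -> 0 <= eta -> exp_summable S eta K -> 0 < delta ->
  (forall s, complex.Re s = sig -> delta <= cabs (P s)) ->
  dpnorm S (wexp (sig - eta)) (fun s => P (s + ((2 * eta)%:C)%C) - P s) rho ->
  rho <= delta / 5 ->
  approx_inv S (wexp sig) P -> approx_inv S (wexp (sig - eta)) P.
Proof.
move=> mS K0 eta0 SK d0 Pd Prho rd.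
have q0 : (0 : R) < 4^-1 by rewrite invr_gt0.
(* A defect of 1/4 leaves room for the perturbation: rho (1 + 1/4) / delta is at most 1/4 because
   rho <= delta / 5, and 1/4 + 1/4 < 1. *)
move=> /(_ 4^-1 q0)[Q [x [Qx Qe]]].
have rho0 : 0 <= rho by apply: dpnorm_ge0 Prho => a _; exact: expR_ge0.
have vS := submult_wexp S (sig - eta).
pose Qs s := Q (s + ((2 * eta)%:C)%C).
(* Sup-norm control costs eta and the translation by 2 eta returns twice as much; the balance is a
   gain of eta. *)
have eqs : sig + eta - 2 * eta = sig - eta by ring.
have Qsk k : dpnorm S (wexp (sig - eta)) (fun s => Qs s ^+ k) (K * ((1 + 4^-1) / delta) ^+ k).
  rewrite -eqs; apply: (@dpnorm_shift _ _ _ _ (fun s => Q s ^+ k)).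
  exact: dpnorm_inverse_powers Qx Qe d0 Pd k.
have fe : dpnorm S (wexp (sig - eta)) (fun s => 1 - P (s + ((2 * eta)%:C)%C) * Qs s) 4^-1.
  apply: (@dpnorm_wexp_mono _ _ (sig - 2 * eta)) => //.
    by rewrite lerD2l lerN2 ler_peMl// ler1n.
  exact: (@dpnorm_shift _ _ _ _ (fun s => 1 - P s * Q s)).
have gq k : dpnorm S (wexp (sig - eta))
    (fun s => ((P (s + ((2 * eta)%:C)%C) - P s) * Qs s) ^+ k) (K * 4^-1 ^+ k).
  apply: dpnorm_weaken (dpnorm_ext _ (dpnormM vS mS (dpnormX vS mS k Prho) (Qsk k))); last first.
    by move=> s; rewrite exprMn.
  rewrite mulrCA -exprMn ler_wpM2l// lerXn2r ?nnegrE ?mulr_ge0 ?invr_ge0 ?(ltW d0)//.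
  rewrite mulrA ler_pdivrMr//; lra.
apply: (@approx_inv_neumann _ _ _ Qs _ K (4^-1 + 4^-1)) => //.
- have := Qsk 1%N; apply: dpnorm_ext => s; by rewrite expr1.
(* 1 - P Qs is the translated defect 1 - P(s + 2 eta) Qs plus the perturbation (P(s + 2 eta) - P)
   Qs. *)
- move=> k; apply: dpnorm_ext (dpnorm_addX vS mS fe gq k) => s.
  by congr (_ ^+ _); ring.
- by lra.
Qed.

(** Linear in tau by 1 - e^(-x) <= x, and uniform in sig >= -1 because the weight is then at most
    e^l. Hence one step width serves all abscissas. *)
Lemma dpnorm_translate_sub S (L : seq (R * C)) sig tau : submonoid S ->
  (forall p, p \in L -> S p.1) -> -1 <= sig -> 0 <= tau ->
  dpnorm S (wexp sig) (fun s => dpoly L (s + (tau%:C)%C) - dpoly L s)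
    (tau * \sum_(p <- L) cabs p.2 * (expR p.1 * p.1)).
Proof.
move=> [S0 SD Sge] LS s1 t0.
exists [seq (p.1, p.2 * (cexpn p.1 (tau%:C)%C - 1)) | p <- L]; split.
- by move=> p /mapP[q /LS qS ->].
- move=> s; rewrite /dpoly big_map -sumrB; apply: eq_bigr => p _ /=.
  by rewrite cexpnD; ring.
rewrite big_map mulr_sumr big_seq [leRHS]big_seq; apply: ler_sum => p pL /=.
have p0 : 0 <= p.1 by apply: Sge; exact: LS.
rewrite cabsM -mulrA [leRHS]mulrCA ler_wpM2l ?cabs_ge0//.
have -> : cexpn p.1 (tau%:C)%C - 1 = - (((1 - expR (- (p.1 * tau)))%:C)%C).
  rewrite cexpn_real; apply/eqP; rewrite eq_complex /=; apply/andP; split; apply/eqP; ring.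
have h : 1 - expR (- (p.1 * tau)) <= p.1 * tau.
  by have := expR_ge1Dx (- (p.1 * tau)); lra.
have h0 : 0 <= 1 - expR (- (p.1 * tau)).
  by rewrite subr_ge0 expR_le1 oppr_le0 mulr_ge0.
rewrite cabsN cabsR//.
have -> : tau * (expR p.1 * p.1) = (p.1 * tau) * expR p.1 by ring.
apply: ler_pM => //; first exact: expR_ge0.
by rewrite /wexp ler_expR; nra.
Qed.

(** Far to the right the constant term dominates: e^(-l sig) <= 1 / (l sig) for l > 0, so [a0^-1] is
    already a good inverse. *)
Lemma approx_inv_far S (L : seq (R * C)) delta : submonoid S ->
  (forall p, p \in L -> S p.1) -> 0 < delta ->
  (forall s, 0 <= complex.Re s -> delta <= cabs (dpoly L s)) ->
  exists sig1, forall sig, sig1 <= sig -> approx_inv S (wexp sig) (dpoly L).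
Proof.
move=> mS LS d0 Ld; have [S0 SD Sge] := mS.
pose A := \sum_(p <- L | p.1 != 0) cabs p.2 / p.1.
have A0 : 0 <= A.
  rewrite /A big_seq_cond sumr_ge0// => p /andP[pL _].
  by rewrite divr_ge0 ?cabs_ge0// Sge//; exact: LS.
(* Makes A / sig at most delta / 4, so that |a0| >= 3 delta / 4 and the relative defect is at most
   1/3; the summand 1 keeps sig positive. *)
exists (4 * A / delta + 1) => sig sigl.
have sA : 0 <= 4 * A / delta by rewrite divr_ge0 ?mulr_ge0// ltW.
have sig0 : 0 < sig by lra.
have Asig : A / sig <= delta / 4.
  rewrite ler_pdivrMr// mulrAC ler_pdivlMr//.
  have : 4 * A / delta <= sig by lra.
  by rewrite ler_pdivrMr//; lra.
pose a0 : C := coef L 0.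
have PA : dpnorm S (wexp sig) (fun s => dpoly L s - a0) (A / sig).
  exists [seq p <- L | p.1 != 0]; split.
  - by move=> p; rewrite mem_filter => /andP[_ /LS].
  - move=> s; rewrite /dpoly big_filter (bigID (fun p : R * C => p.1 == 0)) /= addrAC.
    rewrite (eq_bigr (fun p => p.2)); first by rewrite -/(coef L 0) subrr add0r.
    by move=> p /eqP ->; rewrite cexpn0 mulr1.
  - rewrite big_filter /A mulr_suml big_seq_cond [leRHS]big_seq_cond.
    apply: ler_sum => p /andP[pL p1]; rewrite -mulrA ler_wpM2l ?cabs_ge0//.
    have p0 : 0 < p.1 by rewrite lt_neqAle eq_sym p1 Sge//; exact: LS.
    rewrite /wexp expRN -invfM lef_pV2 ?posrE ?expR_gt0 ?mulr_gt0//.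
    by have := expR_ge1Dx (p.1 * sig); lra.
have a0d : delta * 3 / 4 <= cabs a0.
  have h1 : delta <= cabs (dpoly L (sig%:C)%C) by apply: Ld => /=; exact: ltW.
  have h2 : cabs (dpoly L (sig%:C)%C - a0) <= A / sig.
    exact: (dpnorm_eval_wexp mS _ PA).
  have := cabsD (dpoly L (sig%:C)%C - a0) a0; rewrite subrK; lra.
have a00 : a0 != 0.
  by apply/eqP => a00; move: a0d; rewrite a00 cabs0; lra.
have vS := submult_wexp S sig.
apply: (@approx_inv_neumann _ _ _ (fun=> a0^-1) (cabs a0^-1) 1 3^-1) => //; last by lra.
  exact: dpnorm_cst.
move=> k; rewrite mul1r; apply: dpnormX => //.
have H := dpnormN (dpnormM vS mS PA (dpnorm_cst vS mS (a0^-1))).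
apply: dpnorm_weaken (dpnorm_ext _ H); last by move=> s; rewrite mulrBl divff// opprB.
rewrite cabsV ler_pdivrMr; lra.
Qed.

(* The line of absolute convergence of 1/P is moved left by a fixed step eta at
   a time until it reaches -eps. *)
Lemma approx_inv_dpoly (E : seq R) (L : seq (R * C)) delta delta' :
  (forall a, a \in E -> 0 < a) -> (forall p, p \in L -> gen E p.1) ->
  0 < delta' -> delta' < delta ->
  (forall s, 0 <= complex.Re s -> delta <= cabs (dpoly L s)) ->
  exists eps, [/\ 0 < eps,
    forall s, - eps <= complex.Re s -> delta' <= cabs (dpoly L s) &
    approx_inv (gen E) (wexp (- eps)) (dpoly L)].
Proof.
move=> E0 LE d'0 d'd Ld.
have mS : submonoid (gen E) by apply: submonoid_gen => a /E0/ltW.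
pose A := \sum_(p <- L) cabs p.2 * (expR p.1 * p.1).
have A0 : 0 <= A.
  rewrite /A big_seq sumr_ge0// => p pL; have [_ _ Sge] := mS.
  by rewrite !mulr_ge0 ?cabs_ge0 ?expR_ge0// Sge//; exact: LE.
(* The cap 1 meets the condition sig >= -1 of [dpnorm_translate_sub]; the quotient lets a shift by
   eps change P by at most delta - delta'; A + 1 is never zero. *)
pose eps := Num.min 1 ((delta - delta') / (A + 1)).
have eps0 : 0 < eps by rewrite lt_min ltr01 divr_gt0 ?subr_gt0//; lra.
have eps1 : eps <= 1 by rewrite ge_min lexx.
have epsA : eps * A <= delta - delta'.
  have h : eps <= (delta - delta') / (A + 1) by rewrite ge_min lexx orbT.
  by rewrite ler_pdivlMr in h; nra.
have Pd s : - eps <= complex.Re s -> delta' <= cabs (dpoly L s).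
  move=> es.
  have h1 : delta <= cabs (dpoly L (s + (eps%:C)%C)).
    by apply: Ld; case: s es => a b /=; lra.
  have h2 : cabs (dpoly L (s + (eps%:C)%C) - dpoly L s) <= eps * A.
    have em1 : -1 <= - eps by rewrite lerN2.
    exact: dpnorm_eval_wexp mS es (dpnorm_translate_sub mS LE em1 (ltW eps0)).
  have := cabsD (dpoly L (s + (eps%:C)%C) - dpoly L s) (dpoly L s); rewrite subrK; lra.
exists eps; split => //.
(* Makes the change of P under translation by 2 eta at most delta' / 5, as [approx_inv_step]
   requires. *)
pose eta := delta' / (10 * (A + 1)).
have eta0 : 0 < eta by rewrite divr_gt0//; lra.
have etaA : 2 * eta * A <= delta' / 5.
  have : eta * (10 * (A + 1)) = delta' by rewrite divfK// gt_eqF//; lra.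
  nra.
(* The grid of abscissas is counted from the target, so the descent ends exactly at -eps. *)
have step n : approx_inv (gen E) (wexp (- eps + n.+1%:R * eta)) (dpoly L) ->
    approx_inv (gen E) (wexp (- eps + n%:R * eta)) (dpoly L).
  have n0 : 0 <= n%:R * eta by rewrite mulr_ge0// ltW.
  have -> : - eps + n%:R * eta = - eps + n.+1%:R * eta - eta by rewrite -natr1; ring.
  have e0 := ltW eta0.
  apply: (approx_inv_step mS _ e0 (gen_exp_summable eta0 E0) d'0 _ _ etaA).
  - exact: gen_const_ge0.
  - by move=> s sR; apply: Pd; rewrite sR -natr1; lra.
  - apply: dpnorm_translate_sub => //; first by rewrite -natr1; lra.
    by rewrite mulr_ge0.
have [sig1 far] := approx_inv_far mS LE (lt_trans d'0 d'd) Ld.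
have [n nh] : exists n : nat, sig1 <= - eps + n%:R * eta.
  exists (Num.truncn ((`|sig1| + eps) / eta)).+1.
  have := truncnS_gt ((`|sig1| + eps) / eta).
  rewrite ltr_pdivrMr//; have := ler_norm sig1; lra.
have {far nh} := far _ nh.
elim: n => [|n IH]; first by rewrite mul0r addr0.
by move=> /step.
Qed.

End ApproximateInverse.

(** * Admissible weights and inversion in the scalar algebra *)

Section Weights.
Variable R : realType.
Local Notation C := (R[i]).
Variables (Lam : set R) (w : R -> R).
Hypothesis mLam : submonoid Lam.
Hypothesis adm : admissible_weight Lam w.

Let LamM k a : Lam a -> Lam (k%:R * a).
Proof.
case: mLam => L0 LD _ La; elim: k => [|k IH]; first by rewrite mul0r.
by rewrite -natr1 mulrDl mul1r; exact: LD.
Qed.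

Lemma weight_submult : submult Lam w.
Proof.
case: adm => -[w1 w0 wD] _; split => // a La.
by apply: le_trans (w1 _ La); exact: ler01.
Qed.

(** Since w(k a)^(1/k) tends to 1, almost all k satisfy w(k a) <= e^(eps k a); the finitely many
    others go into K. *)
Lemma weight_multiples a eps : Lam a -> 0 < a -> 0 < eps ->
  exists K, 0 <= K /\ forall k : nat, w (k%:R * a) <= K * wexp (- eps) (k%:R * a).
Proof.
move=> La a0 e0; case: adm => -[w1 _ _] /(_ a La) wcv.
have wk1 k : 1 <= w (k%:R * a) by apply: w1; exact: LamM.
have ea : (1 : R) < expR (eps * a) by rewrite expR_gt1 mulr_gt0.
have [N _ Nh] := cvgr_lt _ wcv _ ea.
(* The 1 serves the tail. With N + 1 summands, k = 0, where 1 / k is a default value, is always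
   covered by the sum. *)
exists (1 + \sum_(k < N.+1) w (k%:R * a)); split.
  by rewrite addr_ge0// sumr_ge0// => k _; apply: le_trans (wk1 _).
move=> k; have ek : 1 <= wexp (- eps) (k%:R * a).
  by rewrite /wexp mulrN opprK leNgt expR_lt1 -leNgt !mulr_ge0// ltW.
have s0 : 0 <= \sum_(k < N.+1) w (k%:R * a).
  by rewrite sumr_ge0// => j _; apply: le_trans (wk1 _).
have [kN|Nk] := ltnP k N.+1.
  apply: (@le_trans _ _ (1 + \sum_(k < N.+1) w (k%:R * a))); last first.
    by rewrite ler_peMr// addr_ge0.
  rewrite (bigD1 (Ordinal kN)) //= addrCA lerDl addr_ge0// sumr_ge0// => j _.
  by apply: le_trans (wk1 _).
have k0 : (k%:R : R) != 0 by rewrite pnatr_eq0 -lt0n; apply: leq_trans Nk.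
have wk0 : 0 <= w (k%:R * a) by apply: le_trans (wk1 _).
apply: (@le_trans _ _ (wexp (- eps) (k%:R * a))); last first.
  by rewrite ler_peMl ?expR_ge0// lerDl.
have := Nh k (ltnW Nk); rewrite /= => h.
have -> : w (k%:R * a) = (w (k%:R * a) `^ k%:R^-1) ^+ k.
  by rewrite -powR_mulrn ?powR_ge0// -powRrM mulVf// powRr1.
have -> : wexp (- eps) (k%:R * a) = expR (eps * a) ^+ k.
  by rewrite /wexp -expRM_natl; congr expR; ring.
by rewrite lerXn2r ?nnegrE ?powR_ge0 ?expR_ge0// ltW.
Qed.

(** Submultiplicativity multiplies the constants of the generators, one factor per element of E,
    which is why E is a finite list. *)
Lemma weight_gen E eps : 0 < eps -> (forall a, a \in E -> Lam a /\ 0 < a) ->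
  exists K, 0 <= K /\ forall l, gen E l -> w l <= K * wexp (- eps) l.
Proof.
move=> e0; have [w00 wge0 wM] := weight_submult.
elim: E => [|a E IH] EL.
  exists 1; split => // l [M]; rewrite inE => /eqP ->.
  by rewrite w00 /wexp mul0r oppr0 expR0 mulr1.
have [La a0] := EL a (mem_head _ _).
have EL' b : b \in E -> Lam b /\ 0 < b by move=> bE; apply: EL; rewrite inE bE orbT.
have [K [K0 HK]] := IH EL'.
have [K' [K'0 HK']] := weight_multiples La a0 e0.
exists (K' * K); split; first exact: mulr_ge0.
move=> l /gen_cons[k [l' [l'E ->]]].
have Ll' : Lam l' by apply: (gen_sub mLam _ l'E) => b /EL'[].
apply: le_trans (wM _ _ (LamM k La) Ll') _.
have -> : wexp (- eps) (k%:R * a + l') = wexp (- eps) (k%:R * a) * wexp (- eps) l'.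
  by rewrite /wexp mulrDl opprD expRD.
rewrite mulrACA.
by apply: ler_pM; rewrite ?wge0 ?HK//; exact: LamM.
Qed.

(** Of the strip of width eps, one half is spent on bounding coefficients by the sup norm, the other
    on absorbing [w]. The powers of Q are recorded because [Dlim_inv] perturbs the polynomial
    afterwards. *)
Lemma dpoly_inverse_powers (L : seq (R * C)) delta delta' :
  (forall p, p \in L -> Lam p.1) -> 0 < delta' -> delta' < delta ->
  (forall s, 0 <= complex.Re s -> delta <= cabs (dpoly L s)) ->
  exists Q x K, [/\ 0 <= K, dpnorm Lam w Q x,
    dpnorm Lam w (fun s => 1 - dpoly L s * Q s) 4^-1 &
    forall k, dpnorm Lam w (fun s => Q s ^+ k) (K * (5 / 4 / delta') ^+ k)].
Proof.
move=> LL d'0 d'd Ld; have [_ _ Lge] := mLam.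
pose E := [seq p.1 | p <- L & p.1 != 0].
have EL a : a \in E -> Lam a /\ 0 < a.
  move=> /mapP[p]; rewrite mem_filter => /andP[p0 pL] ->; split; first exact: LL.
  by rewrite lt_neqAle eq_sym p0 Lge//; exact: LL.
have LE p : p \in L -> gen E p.1.
  move=> pL; have [->|p0] := eqVneq p.1 0; first by exists 0%N; exact: combs0.
  by apply: mem_gen; rewrite map_f// mem_filter p0.
have E0 a : a \in E -> 0 < a by move=> /EL[].
have mE : submonoid (gen E) by apply: submonoid_gen => a /E0/ltW.
have EsubL : gen E `<=` Lam by apply: gen_sub => // a /EL[].
have [eps [eps0 Pd inv]] := approx_inv_dpoly E0 LE d'0 d'd Ld.
have e20 : 0 < eps / 2 by rewrite divr_gt0.
have [K [K0 HK]] := weight_gen e20 EL.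
have toLam g x : dpnorm (gen E) (wexp (- (eps / 2))) g x -> dpnorm Lam w g (K * x).
  by apply: dpnorm_mono.
(* Chosen so that the factor K lost in the passage to [Lam] leaves a defect of at most 1/4. *)
have c0 : 0 < (4 * (K + 1))^-1 by rewrite invr_gt0 mulr_gt0//; lra.
have [Q [x [Qx Qe]]] := inv _ c0.
have cle : (4 * (K + 1))^-1 <= 4^-1.
  by rewrite lef_pV2 ?posrE ?mulr_gt0//; lra.
have mono g y : dpnorm (gen E) (wexp (- eps)) g y -> dpnorm (gen E) (wexp (- (eps / 2))) g y.
  by apply: dpnorm_wexp_mono => //; lra.
exists Q, (K * x), (K * gen_const E (eps / 2)); split.
- by apply: mulr_ge0 => //; apply: gen_const_ge0 => //; exact: ltW.
- by apply: toLam; exact: mono.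
- apply: dpnorm_weaken (toLam _ _ (mono _ _ Qe)).
  have : (4 * (K + 1))^-1 * (4 * (K + 1)) = 1 by rewrite mulVf// gt_eqF// mulr_gt0//; lra.
  by nra.
- move=> k; rewrite -mulrA; apply: toLam.
  have Pd' s : complex.Re s = - eps -> delta' <= cabs (dpoly L s).
    by move=> es; apply: Pd; rewrite es.
  have H := dpnorm_inverse_powers mE (gen_exp_summable e20 E0) Qx Qe d'0 Pd' k.
  have -> : - (eps / 2) = - eps + eps / 2 by lra.
  apply: dpnorm_weaken H; apply: ler_wpM2l.
    by apply: gen_const_ge0 => //; exact: ltW.
  apply: lerXn2r; rewrite ?nnegrE ?divr_ge0// ?(ltW d'0)//; first by lra.
  by rewrite ler_wpM2r ?invr_ge0 ?(ltW d'0)//; lra.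
Qed.

(* The scalar algebra D(Lam, w, C), as the completion of the Dirichlet
   polynomials, its elements being identified with their sums on [inH]. *)
Definition Dlim (h : C -> C) : Prop := exists Q : nat -> C -> C,
  [/\ forall n, exists x, dpnorm Lam w (Q n) x,
      forall e : R, 0 < e -> exists N, forall n m, (N <= n)%N -> (N <= m)%N ->
        dpnorm Lam w (fun s => Q n s - Q m s) e &
      forall s, inH s -> forall e : R, 0 < e ->
        exists N, forall n, (N <= n)%N -> cabs (Q n s - h s) <= e].

Lemma dpnorm_eval_inH g x s : inH s -> dpnorm Lam w g x -> cabs (g s) <= x.
Proof.
move=> sH; apply: dpnorm_eval => l Ll.
case: adm => -[w1 _ _] _; apply: le_trans (w1 _ Ll).
by case: mLam => _ _ Lge; rewrite /wexp expR_le1 oppr_le0 mulr_ge0// Lge.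
Qed.

Let wS := weight_submult.

Let w_ge0 : forall a, Lam a -> 0 <= w a.
Proof. by case: wS. Qed.

Lemma Dlim_ext g h : (forall s, inH s -> g s = h s) -> Dlim g -> Dlim h.
Proof.
by move=> gh [Q [a b c]]; exists Q; split => // s sH; rewrite -gh//; exact: c.
Qed.

(** On [inH] the norm dominates the sup norm, so norm-Cauchy approximants that converge pointwise
    converge uniformly. *)
Lemma Dlim_unif (h : C -> C) (Q : nat -> C -> C) :
  (forall e : R, 0 < e -> exists N, forall n m, (N <= n)%N -> (N <= m)%N ->
        dpnorm Lam w (fun s => Q n s - Q m s) e) ->
  (forall s, inH s -> forall e : R, 0 < e ->
        exists N, forall n, (N <= n)%N -> cabs (Q n s - h s) <= e) ->
  forall e : R, 0 < e -> exists N, forall n s, (N <= n)%N -> inH s ->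
     cabs (Q n s - h s) <= e.
Proof.
move=> QC Qh e e0; have e20 : 0 < e / 2 by rewrite divr_gt0.
have [N HN] := QC _ e20; exists N => n s Nn sH.
have [M HM] := Qh s sH _ e20.
have h1 := HM (maxn M N) (leq_maxl _ _).
have h2 := dpnorm_eval_inH sH (HN n (maxn M N) Nn (leq_maxr _ _)).
by have := cabs_dist_triangle (Q n s) (Q (maxn M N) s) (h s); lra.
Qed.

Lemma cauchy_dpnorm_bounded (Q : nat -> C -> C) :
  (forall n, exists x, dpnorm Lam w (Q n) x) ->
  (forall e : R, 0 < e -> exists N, forall n m, (N <= n)%N -> (N <= m)%N ->
        dpnorm Lam w (fun s => Q n s - Q m s) e) ->
  exists B N, 0 <= B /\ forall n, (N <= n)%N -> dpnorm Lam w (Q n) B.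
Proof.
move=> Qx QC; have [N HN] := QC 1 ltr01.
have [x Hx] := Qx N; exists (1 + x), N; split.
  by rewrite addr_ge0//; exact: dpnorm_ge0 Hx.
move=> n Nn; apply: dpnorm_ext (dpnormD (HN n N Nn (leqnn _)) Hx) => s.
by rewrite subrK.
Qed.

Lemma Dlim_cst c : Dlim (fun=> c).
Proof.
exists (fun _ _ => c); split.
- by move=> _; exists (cabs c); exact: dpnorm_cst.
- move=> e e0; exists 0%N => n m _ _; apply: dpnorm_ext (dpnorm0 _ _ (ltW e0)) => s.
  by rewrite subrr.
- by move=> s _ e e0; exists 0%N => n _; rewrite subrr cabs0 ltW.
Qed.

Lemma DlimD g h : Dlim g -> Dlim h -> Dlim (fun s => g s + h s).
Proof.
move=> [Q [Qx QC Qg]] [P [Px PC Ph]]; exists (fun n s => Q n s + P n s); split.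
- by move=> n; have [x ?] := Qx n; have [y ?] := Px n; exists (x + y); exact: dpnormD.
- move=> e e0; have e20 : 0 < e / 2 by rewrite divr_gt0.
  have [N HN] := QC _ e20; have [M HM] := PC _ e20.
  exists (maxn N M) => n m; rewrite !geq_max => /andP[a b] /andP[c d].
  have -> : e = e / 2 + e / 2 by lra.
  by apply: dpnorm_ext (dpnormD (HN n m a c) (HM n m b d)) => s; ring.
- move=> s sH e e0; have e20 : 0 < e / 2 by rewrite divr_gt0.
  have [N HN] := Qg s sH _ e20; have [M HM] := Ph s sH _ e20.
  exists (maxn N M) => n; rewrite geq_max => /andP[/HN a /HM b].
  have -> : Q n s + P n s - (g s + h s) = (Q n s - g s) + (P n s - h s) by ring.
  by apply: le_trans (cabsD _ _) _; lra.
Qed.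

Lemma Dlim_bounded h : Dlim h -> exists B, 0 <= B /\ forall s, inH s -> cabs (h s) <= B.
Proof.
move=> [Q [Qx QC Qh]].
have [B [N [B0 HB]]] := cauchy_dpnorm_bounded Qx QC.
have [M HM] := Dlim_unif QC Qh ltr01.
exists (B + 1); split; first lra.
move=> s sH; have h1 := HM _ s (leq_maxr N M) sH.
have h2 := dpnorm_eval_inH sH (HB _ (leq_maxl N M)).
have := cabsB (Q (maxn N M) s) (Q (maxn N M) s - h s); rewrite opprB addrCA subrr addr0.
lra.
Qed.

Lemma DlimM g h : Dlim g -> Dlim h -> Dlim (fun s => g s * h s).
Proof.
move=> Dg Dh; have [Bg [Bg0 HBg]] := Dlim_bounded Dg.
move: Dg Dh => [Q [Qx QC Qg]] [P [Px PC Ph]]; exists (fun n s => Q n s * P n s).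
have [BQ [NQ [BQ0 HBQ]]] := cauchy_dpnorm_bounded Qx QC.
have [BP [NP [BP0 HBP]]] := cauchy_dpnorm_bounded Px PC.
(* Dominates BQ + BP for the Cauchy estimate and BP + Bg for the limit; the 1 makes it positive. *)
pose c := BQ + BP + Bg + 1.
have c0 : 0 < c by rewrite /c; lra.
split.
- by move=> n; have [x ?] := Qx n; have [y ?] := Px n; exists (x * y); exact: dpnormM.
- move=> e e0; have e20 : 0 < e / 2 / c by rewrite !divr_gt0.
  have [N HN] := QC _ e20; have [M HM] := PC _ e20.
  exists (maxn (maxn N M) (maxn NQ NP)) => n m.
  rewrite !geq_max => /andP[/andP[a b] /andP[a' b']] /andP[/andP[c1 d] /andP[c' d']].
  have H := dpnormD (dpnormM wS mLam (HN n m a c1) (HBP n b'))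
                    (dpnormM wS mLam (HBQ m c') (HM n m b d)).
  apply: dpnorm_weaken (dpnorm_ext _ H); last by move=> s; ring.
  have : e / 2 / c * c = e / 2 by rewrite divfK// gt_eqF.
  by rewrite /c; nra.
- move=> s sH e e0; have e20 : 0 < e / 2 / c by rewrite !divr_gt0.
  have [N HN] := Qg s sH _ e20; have [M HM] := Ph s sH _ e20.
  exists (maxn (maxn N M) NP) => n; rewrite !geq_max => /andP[/andP[/HN a /HM b] /HBP d].
  have Pn := dpnorm_eval_inH sH d; have gs := HBg s sH.
  have -> : Q n s * P n s - g s * h s =
    (Q n s - g s) * P n s + g s * (P n s - h s) by ring.
  apply: le_trans (cabsD _ _) _; rewrite !cabsM.
  apply: (@le_trans _ _ (e / 2 / c * BP + Bg * (e / 2 / c))).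
    by apply: lerD; apply: ler_pM; rewrite ?cabs_ge0.
  have : e / 2 / c * c = e / 2 by rewrite divfK// gt_eqF.
  by rewrite /c; nra.
Qed.

Lemma Dlim_sum (I : Type) (r : seq I) (P : pred I) (h : I -> C -> C) :
  (forall i, Dlim (h i)) -> Dlim (fun s => \sum_(i <- r | P i) h i s).
Proof.
move=> Dh; elim: r => [|i r IH].
  by apply: Dlim_ext (Dlim_cst 0) => s _; rewrite big_nil.
have [Pi|Pi] := boolP (P i).
  by apply: Dlim_ext (DlimD (Dh i) IH) => s _; rewrite big_cons Pi.
by apply: Dlim_ext IH => s _; rewrite big_cons (negPf Pi).
Qed.

Lemma Dlim_prod (I : Type) (r : seq I) (P : pred I) (h : I -> C -> C) :
  (forall i, Dlim (h i)) -> Dlim (fun s => \prod_(i <- r | P i) h i s).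
Proof.
move=> Dh; elim: r => [|i r IH].
  by apply: Dlim_ext (Dlim_cst 1) => s _; rewrite big_nil.
have [Pi|Pi] := boolP (P i).
  by apply: Dlim_ext (DlimM (Dh i) IH) => s _; rewrite big_cons Pi.
by apply: Dlim_ext IH => s _; rewrite big_cons (negPf Pi).
Qed.

Lemma Dlim_det n (M : C -> 'M[C]_n) :
  (forall i j, Dlim (fun s => M s i j)) -> Dlim (fun s => \det (M s)).
Proof.
move=> DM; rewrite /determinant; apply: Dlim_sum => p.
by apply: DlimM; [exact: Dlim_cst|exact: Dlim_prod].
Qed.

Lemma Dlim_adj n (M : C -> 'M[C]_n) i j :
  (forall i j, Dlim (fun s => M s i j)) -> Dlim (fun s => (\adj (M s)) i j).
Proof.
move=> DM.
apply: (@Dlim_ext (fun s => cofactor (M s) j i)); first by move=> s _; rewrite mxE.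
apply: DlimM; first exact: Dlim_cst.
apply: Dlim_det => a b; apply: Dlim_ext (DM (lift j a) (lift i b)) => s _.
by rewrite !mxE.
Qed.

(** One polynomial P_N close to h is inverted approximately by Q, and the same Q serves every later
    P_n, since P_N - P_n is small in norm and the powers of Q are controlled. *)
Lemma Dlim_inv h delta : Dlim h -> 0 < delta ->
  (forall s, inH s -> delta <= cabs (h s)) -> Dlim (fun s => (h s)^-1).
Proof.
move=> [P [Px PC Ph]] d0 hd.
have [BP [NP [BP0 HBP]]] := cauchy_dpnorm_bounded Px PC.
(* With delta / 8, |P_N| stays above 7 delta / 8 > 3 delta / 4, and delta / 8 times (5/4) / (3 delta
   / 4) is 5/24, below 1/4. *)
have d80 : 0 < delta / 8 by rewrite divr_gt0.
have [N1 HN1] := PC _ d80; have [N2 HN2] := Dlim_unif PC Ph d80.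
pose N := maxn (maxn N1 N2) NP.
have [N1N N2N NPN] : [/\ N1 <= N, N2 <= N & NP <= N]%N.
  by rewrite /N !leq_max !leqnn !orbT.
have [x0 [L [LL PL _]]] := Px N.
have Ld s : 0 <= complex.Re s -> delta * (7 / 8) <= cabs (dpoly L s).
  move=> sH; rewrite -PL; have := HN2 N s N2N sH; have := hd s sH.
  have := cabsB (P N s) (P N s - h s); rewrite opprB addrCA subrr addr0; lra.
have d'0 : 0 < delta * (3 / 4) by lra.
have d'd : delta * (3 / 4) < delta * (7 / 8) by lra.
have [Q [x [K [K0 Qx Qe Qk]]]] := dpoly_inverse_powers LL d'0 d'd Ld.
have x_ge0 : 0 <= x by exact: dpnorm_ge0 Qx.
have powers n : (N <= n)%N -> forall k,
    dpnorm Lam w (fun s => (1 - P n s * Q s) ^+ k) (K * (4^-1 + 4^-1) ^+ k).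
  move=> Nn k.
  have gq j : dpnorm Lam w (fun s => ((P N s - P n s) * Q s) ^+ j) (K * 4^-1 ^+ j).
    have PnN := HN1 N n N1N (leq_trans N1N Nn).
    have H := dpnormM wS mLam (dpnormX wS mLam j PnN) (Qk j).
    apply: dpnorm_weaken (dpnorm_ext _ H); last by move=> s; rewrite exprMn.
    rewrite mulrCA -exprMn ler_wpM2l//; apply: lerXn2r; rewrite ?nnegrE//.
      by rewrite mulr_ge0 ?divr_ge0// ltW.
    by rewrite mulrA ler_pdivrMr//; lra.
  apply: dpnorm_ext (dpnorm_addX wS mLam Qe gq k) => s.
  by congr (_ ^+ _); rewrite -PL; ring.
have th0 : (0 : R) <= 4^-1 + 4^-1 by lra.
have th1 : (4^-1 + 4^-1 : R) < 1 by lra.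
(* A diagonal choice: index and truncation grow together while the norm stays below B. *)
pose G n := neumann (P (N + n)%N) Q n.
pose B := x * (K * (1 - (4^-1 + 4^-1))^-1).
have GB n : dpnorm Lam w (G n) B.
  by apply: dpnorm_neumann => //; apply: powers; exact: leq_addr.
have B0 : 0 <= B by exact: dpnorm_ge0 (GB 0%N).
have PG n : dpnorm Lam w (fun s => 1 - P (N + n)%N s * G n s) (K * (4^-1 + 4^-1) ^+ n).
  by apply: dpnorm_ext (powers _ (leq_addr _ _) n) => s; rewrite neumannE.
pose c := 2 * B + B * B + 1.
have c0 : 0 < c by rewrite /c; nra.
exists G; split.
- by move=> n; exists B.
- move=> e e0; have ec0 : 0 < e / c by rewrite divr_gt0.
  have [M HM] := geometric_small K th0 th1 ec0; have [M' HM'] := PC _ ec0.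
  exists (maxn M M') => n m; rewrite !geq_max => /andP[a b] /andP[a' b'].
  have bm : (M' <= N + m)%N by apply: leq_trans (leq_addl _ _).
  have bn : (M' <= N + n)%N by apply: leq_trans (leq_addl _ _).
  (* With P_n for [P (N + n)]: G_n - G_m = G_n (1 - P_m G_m) - G_m (1 - P_n G_n) + G_n G_m (P_m -
     P_n), and [c] adds up the bounds of the cofactors. *)
  have H := dpnormD (dpnormB
     (dpnormM wS mLam (GB n) (dpnorm_weaken (HM m a') (PG m)))
     (dpnormM wS mLam (GB m) (dpnorm_weaken (HM n a) (PG n))))
     (dpnormM wS mLam (dpnormM wS mLam (GB n) (GB m)) (HM' _ _ bm bn)).
  apply: dpnorm_weaken (dpnorm_ext _ H); last by move=> s; ring.
  have : e / c * c = e by rewrite divfK// gt_eqF.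
  by rewrite /c; nra.
- move=> s sH e e0; have ec0 : 0 < e * delta / (B + 1) by rewrite divr_gt0 ?mulr_gt0//; lra.
  have [M HM] := geometric_small K th0 th1 ec0; have [M' HM'] := Ph s sH _ ec0.
  exists (maxn M M') => n; rewrite geq_max => /andP[a b].
  have h0 : h s != 0.
    by apply/eqP => h0; have := hd s sH; rewrite h0 cabs0 leNgt d0.
  have h1 := dpnorm_eval_inH sH (GB n).
  have h2 := HM' (N + n)%N (leq_trans b (leq_addl _ _)).
  have h3 := le_trans (dpnorm_eval_inH sH (PG n)) (HM n a).
  have -> : G n s - (h s)^-1 = - (h s)^-1 *
     (G n s * (P (N + n)%N s - h s) + (1 - P (N + n)%N s * G n s)).
    by field.
  rewrite cabsM cabsN cabsV mulrC ler_pdivrMr; last exact: lt_le_trans (hd s sH).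
  apply: (@le_trans _ _ (e * delta)); last by rewrite ler_wpM2l ?hd// ltW.
  apply: le_trans (cabsD _ _) _; rewrite cabsM.
  have : e * delta / (B + 1) * (B + 1) = e * delta by rewrite divfK// gt_eqF//; lra.
  have := ler_pM (cabs_ge0 _) (cabs_ge0 _) h1 h2.
  by nra.
Qed.

End Weights.

(** * Complex limits along filters *)

Lemma invS_small (R : realType) (e : R) : 0 < e ->
  exists N, forall n, (N <= n)%N -> (n.+1%:R : R)^-1 <= e.
Proof.
move=> e0; exists (Num.truncn e^-1) => n Nn.
rewrite invf_ple ?posrE//; apply: ltW.
by apply: lt_le_trans (truncnS_gt _) _; rewrite ler_nat.
Qed.

Section ComplexLimits.
Variable R : realType.
Local Notation C := (R[i]).

Lemma cabs_cauchy_lim (z : nat -> C) :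
  (forall e : R, 0 < e -> exists N, forall n m, (N <= n)%N -> (N <= m)%N ->
     cabs (z n - z m) <= e) ->
  exists l, forall e : R, 0 < e -> exists N, forall n, (N <= n)%N -> cabs (z n - l) <= e.
Proof.
have real_lim (u : nat -> R) :
  (forall e : R, 0 < e -> exists N, forall n m, (N <= n)%N -> (N <= m)%N ->
     `|u n - u m| <= e) ->
  exists l, forall e : R, 0 < e -> exists N, forall n, (N <= n)%N -> `|u n - l| <= e.
  move=> uC; have : cvg (u @ \oo).
    apply/cauchy_cvgP; apply: cauchy_exP => e e0.
    have [N HN] := uC _ (divr_gt0 e0 (ltr0Sn R 1)).
    exists (u N); exists N => // n /= Nn; rewrite /ball /=.
    by apply: le_lt_trans (HN N n (leqnn _) Nn) _; rewrite ltr_pdivrMr// ltr_pMr// ltr1n.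
  move=> /cvg_ex[l /cvgrPdist_le ul]; exists l => e /ul[N _ HN].
  by exists N => n Nn; rewrite distrC; exact: HN.
move=> zC.
have [a Ha] : exists l, forall e : R, 0 < e -> exists N, forall n, (N <= n)%N ->
    `|complex.Re (z n) - l| <= e.
  apply: real_lim => e /zC[N HN]; exists N => n m Nn Nm.
  rewrite -raddfB; exact: le_trans (normRe_le_cabs _) (HN _ _ Nn Nm).
have [b Hb] : exists l, forall e : R, 0 < e -> exists N, forall n, (N <= n)%N ->
    `|complex.Im (z n) - l| <= e.
  apply: real_lim => e /zC[N HN]; exists N => n m Nn Nm.
  rewrite -raddfB; exact: le_trans (normIm_le_cabs _) (HN _ _ Nn Nm).
exists (Complex a b) => e e0; have e20 : 0 < e / 2 by rewrite divr_gt0.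
have [N HN] := Ha _ e20; have [M HM] := Hb _ e20.
exists (maxn N M) => n; rewrite geq_max => /andP[/HN h1 /HM h2].
apply: le_trans (cabs_le_ReIm _) _; rewrite !raddfB /=; lra.
Qed.

(** The filter is arbitrary because both sequential limits and ultrafilter limits of determinants
    occur. *)
Definition clim (F : set_system nat) (z : nat -> C) (l : C) : Prop :=
  forall e : R, 0 < e -> F [set n | cabs (z n - l) <= e].

Section Clim.
Variable F : set_system nat.
Hypothesis FF : Filter F.

Lemma clim_cst c : clim F (fun=> c) c.
Proof.
move=> e e0; apply: filterS filterT => n _ /=.
by rewrite subrr cabs0 ltW.
Qed.

Lemma climD y z k l : clim F y k -> clim F z l -> clim F (fun n => y n + z n) (k + l).
Proof.
move=> yk zl e e0; have e20 : 0 < e / 2 by rewrite divr_gt0.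
apply: filterS2 (yk _ e20) (zl _ e20) => n /= a b.
have -> : y n + z n - (k + l) = (y n - k) + (z n - l) by ring.
by apply: le_trans (cabsD _ _) _; lra.
Qed.

Lemma climM y z k l : clim F y k -> clim F z l -> clim F (fun n => y n * z n) (k * l).
Proof.
move=> yk zl e e0; pose c := cabs k + cabs l + 1.
have c0 : 0 < c by rewrite /c; have := cabs_ge0 k; have := cabs_ge0 l; lra.
(* As r <= 1, the quadratic term is at most r and the whole error at most r c. *)
pose r := Num.min 1 (e / 2 / c).
have r0 : 0 < r by rewrite lt_min ltr01 !divr_gt0.
have r1 : r <= 1 by rewrite ge_min lexx.
have rc : r * c <= e / 2.
  by rewrite -ler_pdivlMr// ge_min lexx orbT.
apply: filterS2 (yk _ r0) (zl _ r0) => n /= a b.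
have -> : y n * z n - k * l = (y n - k) * (z n - l) + (y n - k) * l + k * (z n - l) by ring.
apply: le_trans (cabsD _ _) _.
have := cabsD ((y n - k) * (z n - l)) ((y n - k) * l); rewrite !cabsM.
have := cabs_ge0 k; have := cabs_ge0 l.
have := cabs_ge0 (y n - k); have := cabs_ge0 (z n - l).
move: rc; rewrite /c.
move: (cabs _) (cabs k) (cabs l) (cabs (y n - k)) (cabs (z n - l)) a b.
move=> t0 t1 t2 t3 t4 a b rc h1 h2 h3 h4 h5.
have := ler_pM h2 h1 a b.
have : t3 * t2 <= r * t2 by rewrite ler_wpM2r.
have : t1 * t4 <= t1 * r by rewrite ler_wpM2l.
nra.
Qed.

Lemma clim_sum (I : Type) (r : seq I) (P : pred I) (z : I -> nat -> C) (l : I -> C) :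
  (forall i, clim F (z i) (l i)) ->
  clim F (fun n => \sum_(i <- r | P i) z i n) (\sum_(i <- r | P i) l i).
Proof.
move=> zl; elim: r => [|i r IH].
  by rewrite big_nil; under [X in clim _ X]funext do rewrite big_nil; exact: clim_cst.
rewrite big_cons; under [X in clim _ X]funext do rewrite big_cons.
by case: ifP => _ //; exact: climD.
Qed.

Lemma clim_prod (I : Type) (r : seq I) (P : pred I) (z : I -> nat -> C) (l : I -> C) :
  (forall i, clim F (z i) (l i)) ->
  clim F (fun n => \prod_(i <- r | P i) z i n) (\prod_(i <- r | P i) l i).
Proof.
move=> zl; elim: r => [|i r IH].
  by rewrite big_nil; under [X in clim _ X]funext do rewrite big_nil; exact: clim_cst.
rewrite big_cons; under [X in clim _ X]funext do rewrite big_cons.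
by case: ifP => _ //; exact: climM.
Qed.

Lemma clim_det d (M : nat -> 'M[C]_d) (A : 'M[C]_d) :
  (forall i j, clim F (fun n => M n i j) (A i j)) ->
  clim F (fun n => \det (M n)) (\det A).
Proof.
move=> MA; rewrite /determinant; apply: clim_sum => p.
by apply: climM; [exact: clim_cst|exact: clim_prod].
Qed.

End Clim.

(** A compact interval gives a cluster point; an ultrafilter contains each set or its complement, so
    a cluster point is already a limit. *)
Lemma ultra_clim (U : set_system nat) (z : nat -> C) (B : R) : UltraFilter U ->
  (forall n, cabs (z n) <= B) -> exists l, clim U z l.
Proof.
move=> UU zB.
have real_lim (u : nat -> R) : (forall n, `|u n| <= B) ->
    exists p, forall e : R, 0 < e -> U [set n | `|u n - p| <= e].
  move=> uB; have uU : U (u @^-1` `[- B, B]).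
    by apply: filterS filterT => n _ /=; rewrite in_itv /= -ler_norml uB.
  have [p [_ cp]] := @segment_compact R (- B) B (u @ U) _ uU.
  exists p => e e0; have [//|Un] := in_ultra_setVsetC [set n | `|u n - p| <= e] UU.
  have [|x [nx bx]] := cp (~` [set x | `|x - p| <= e]) (ball p e) Un.
    exact: nbhsx_ballx.
  case: nx; move: bx; rewrite /ball /= distrC; exact: ltW.
have [a Ha] : exists p, forall e : R, 0 < e -> U [set n | `|complex.Re (z n) - p| <= e].
  by apply: real_lim => n; apply: le_trans (normRe_le_cabs _) _.
have [b Hb] : exists p, forall e : R, 0 < e -> U [set n | `|complex.Im (z n) - p| <= e].
  by apply: real_lim => n; apply: le_trans (normIm_le_cabs _) _.
exists (Complex a b) => e e0; have e20 : 0 < e / 2 by rewrite divr_gt0.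
apply: filterS2 (Ha _ e20) (Hb _ e20) => n /= h1 h2.
apply: le_trans (cabs_le_ReIm _) _; rewrite !raddfB /=; lra.
Qed.

End ComplexLimits.

(** * Unconditional sums and norm-Cauchy polynomials describe the same functions *)

Section ScalarSums.
Variable R : realType.
Local Notation C := (R[i]).
Variables (Lam : set R) (w : R -> R).
Hypothesis mLam : submonoid Lam.
Hypothesis adm : admissible_weight Lam w.

Definition fin_sub (X : seq R) : Prop := uniq X /\ forall l, l \in X -> Lam l.

Definition abs_sum_le (c : R -> C) (B : R) : Prop :=
  forall X, fin_sub X -> \sum_(l <- X) cabs (c l) * w l <= B.

Definition scalar_sum (c : R -> C) (s v : C) : Prop :=
  forall e : R, 0 < e -> exists2 X0, fin_sub X0 & forall X, fin_sub X ->
    {subset X0 <= X} -> cabs (\sum_(l <- X) c l * cexpn l s - v) <= e.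

Let w_ge1 : forall l, Lam l -> 1 <= w l.
Proof. by case: adm => -[]. Qed.

Let w_ge0 l : Lam l -> 0 <= w l.
Proof. by move=> /w_ge1; apply: le_trans. Qed.

Lemma cabs_sum_le_weighted (c : R -> C) X s : inH s -> (forall l, l \in X -> Lam l) ->
  cabs (\sum_(l <- X) c l * cexpn l s) <= \sum_(l <- X) cabs (c l) * w l.
Proof.
move=> sH XL; apply: le_trans (cabs_sum _ _ _) _.
rewrite big_seq [leRHS]big_seq; apply: ler_sum => l /XL Ll.
rewrite cabsM cabs_cexpn ler_wpM2l ?cabs_ge0//; apply: le_trans (w_ge1 Ll).
by case: mLam => _ _ Lge; rewrite expR_le1 oppr_le0 mulr_ge0// Lge.
Qed.

Lemma sum_setdiff (V : zmodType) (X Y : seq R) (f : R -> V) : uniq X -> uniq Y ->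
  \sum_(l <- X) f l - \sum_(l <- Y) f l =
  \sum_(l <- X | l \notin Y) f l - \sum_(l <- Y | l \notin X) f l.
Proof.
move=> uX uY; rewrite (bigID (fun l => l \in Y)) /= [X in _ - X](bigID (fun l => l \in X)) /=.
have -> : \sum_(l <- X | l \in Y) f l = \sum_(l <- Y | l \in X) f l.
  rewrite -big_filter -[RHS]big_filter; apply: perm_big; apply: uniq_perm; rewrite ?filter_uniq//.
  by move=> l; rewrite !mem_filter andbC.
by rewrite opprD addrACA subrr add0r.
Qed.

(** A finite sum within e of the supremum leaves less than e for anything disjoint from it. *)
Lemma small_tail c B : abs_sum_le c B -> forall e : R, 0 < e -> exists2 X, fin_sub X &
  forall Y, fin_sub Y -> (forall l, l \in Y -> l \notin X) ->
    \sum_(l <- Y) cabs (c l) * w l <= e.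
Proof.
move=> cB e e0.
pose A : set R := [set x | exists2 X, fin_sub X & x = \sum_(l <- X) cabs (c l) * w l].
have supA : has_sup A.
  split; first by exists (\sum_(l <- [::]) cabs (c l) * w l); exists [::].
  by exists B => x [X fX ->]; exact: cB.
have [_ [X fX ->] hX] := sup_adherent e0 supA.
exists X => // Y fY YX; have [uX XL] := fX; have [uY YL] := fY.
have : \sum_(l <- X ++ Y) cabs (c l) * w l <= sup A.
  apply: ub_le_sup; first by case: supA.
  exists (X ++ Y) => //; split.
    rewrite cat_uniq uX uY andbT /=; apply/hasPn => l /YX; exact.
  by move=> l; rewrite mem_cat => /orP[/XL|/YL].
rewrite big_cat /=; lra.
Qed.

Lemma Dlim_of_scalar_sum c B h : abs_sum_le c B ->
  (forall s, inH s -> scalar_sum c s (h s)) -> Dlim Lam w h.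
Proof.
move=> cB ch; have tail := small_tail cB.
have inv0 n : 0 < (n.+1%:R : R)^-1 by rewrite invr_gt0.
have /choice[X HX] (n : nat) : exists X, fin_sub X /\
    forall Y, fin_sub Y -> (forall l, l \in Y -> l \notin X) ->
    \sum_(l <- Y) cabs (c l) * w l <= n.+1%:R^-1.
  by have [X ? ?] := tail _ (inv0 n); exists X.
pose T (Y : seq R) := [seq (l, c l) | l <- Y].
have dT Y s : dpoly (T Y) s = \sum_(l <- Y) c l * cexpn l s by rewrite /dpoly big_map.
have nT (Y : seq R) : (forall l, l \in Y -> Lam l) ->
    dpnorm Lam w (dpoly (T Y)) (\sum_(l <- Y) cabs (c l) * w l).
  move=> YL; exists (T Y); split => //; first by move=> p /mapP[l /YL ? ->].
  by rewrite big_map.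
have fF (Y Z : seq R) : fin_sub Y -> fin_sub [seq l <- Y | l \notin Z].
  move=> [uY YL]; split; first exact: filter_uniq.
  by move=> l; rewrite mem_filter => /andP[_ /YL].
exists (fun n => dpoly (T (X n))); split.
- by move=> n; exists (\sum_(l <- X n) cabs (c l) * w l); apply: nT; case: (HX n) => -[].
- move=> e e0; have e20 : 0 < e / 2 by rewrite divr_gt0.
  have [N HN] := invS_small e20; exists N => n m /HN a /HN b.
  have [fn tn] := HX n; have [fm tm] := HX m.
  (* X n and X m need not be nested: X n minus X m lies in the tail of X m and vice versa, whence
     the crossed use of [tm] and [tn]. *)
  have Dn := nT _ (fF (X n) (X m) fn).2; have Dm := nT _ (fF (X m) (X n) fm).2.
  apply: dpnorm_weaken (dpnorm_ext _ (dpnormB Dn Dm)).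
    have h1 : \sum_(l <- [seq l <- X n | l \notin X m]) cabs (c l) * w l <= m.+1%:R^-1.
      by apply: tm; [exact: fF|move=> l; rewrite mem_filter => /andP[]].
    have h2 : \sum_(l <- [seq l <- X m | l \notin X n]) cabs (c l) * w l <= n.+1%:R^-1.
      by apply: tn; [exact: fF|move=> l; rewrite mem_filter => /andP[]].
    by rewrite [leRHS]splitr; apply: lerD; [exact: le_trans h1 b|exact: le_trans h2 a].
  move=> s; rewrite !dT !big_filter -sum_setdiff//; [by case: fn|by case: fm].
- move=> s sH e e0; have e20 : 0 < e / 2 by rewrite divr_gt0.
  have [N HN] := invS_small e20; exists N => n /HN a.
  have [fn tn] := HX n; have [X0 fX0 HX0] := ch s sH _ e20.
  (* Adding the missing part of X0 reaches the range where the sum is close to h s; that part lies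
     in the tail of X n. *)
  pose Z := [seq l <- X0 | l \notin X n].
  have fZ : fin_sub Z by exact: fF.
  have [un nL] := fn; have [uZ ZL] := fZ.
  have fXZ : fin_sub (X n ++ Z).
    split.
      rewrite cat_uniq un uZ andbT /=; apply/hasPn => l.
      by rewrite mem_filter => /andP[].
    by move=> l; rewrite mem_cat => /orP[/nL|/ZL].
  have h1 := HX0 _ fXZ.
  have {h1} h1 : cabs (\sum_(l <- X n ++ Z) c l * cexpn l s - h s) <= e / 2.
    by apply: h1 => l lX0; rewrite mem_cat mem_filter lX0 andbT orbN.
  have h2 := cabs_sum_le_weighted c sH ZL.
  have h3 : \sum_(l <- Z) cabs (c l) * w l <= n.+1%:R^-1.
    by apply: tn => // l; rewrite mem_filter => /andP[].
  have {h3 a} h2 := le_trans h2 (le_trans h3 a).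
  move: h1; rewrite big_cat /= dT => h1.
  set x := \sum_(l <- X n) _ in h1 *; set y := \sum_(l <- Z) _ in h1 h2.
  have -> : x - h s = (x + y - h s) - y by ring.
  by apply: le_trans (cabsB _ _) _; lra.
Qed.

(** [coef_bound] with bound 0, applied to the difference of the two polynomials. *)
Lemma coef_uniq (L L' : seq (R * C)) : (forall s, dpoly L s = dpoly L' s) ->
  forall l, coef L l = coef L' l.
Proof.
move=> LL' l; pose N := [seq (p.1, - p.2) | p <- L'].
have coefN : coef N l = - coef L' l.
  by rewrite /coef big_map sumrN.
have dN s : dpoly N s = - dpoly L' s.
  by rewrite /dpoly big_map -sumrN; apply: eq_bigr => p _; rewrite mulNr.
have : cabs (coef (L ++ N) l) * wexp 0 l <= 0.
  apply: coef_bound => s _; by rewrite dpoly_cat dN LL' subrr cabs0.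
rewrite /wexp mulr0 oppr0 expR0 mulr1 coef_cat coefN => h.
apply/eqP; rewrite -subr_eq0; apply/eqP; apply: cabs_eq0.
by apply/eqP; rewrite eq_le h cabs_ge0.
Qed.

(** Completeness of the weighted l^1: coefficients are Cauchy one by one, and Cauchy bounds uniform
    over finite sets survive the limit. *)
Lemma scalar_sum_of_Dlim h : Dlim Lam w h ->
  exists c B, abs_sum_le c B /\ forall s, inH s -> scalar_sum c s (h s).
Proof.
move=> [Q [Qx QC Qh]].
have /choice[L HL] (n : nat) : exists L,
    (forall p, p \in L -> Lam p.1) /\ forall s, Q n s = dpoly L s.
  by have [x [L [? ? _]]] := Qx n; exists L.
pose q n := coef (L n).
have qC e : 0 < e -> exists N, forall n m, (N <= n)%N -> (N <= m)%N ->
    forall X, fin_sub X -> \sum_(l <- X) cabs (q n l - q m l) * w l <= e.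
  move=> /QC[N HN]; exists N => n m Nn Nm X [uX XL].
  have [M [MS Mh Mle]] := HN n m Nn Nm.
  apply: le_trans Mle; apply: le_trans (sum_coef_le w_ge0 MS uX).
  rewrite le_eqVlt; apply/orP; left; apply/eqP; apply: eq_bigr => l _; congr (cabs _ * _).
  rewrite /q; apply/eqP; rewrite subr_eq -coef_cat; apply/eqP; apply: coef_uniq => s.
  by rewrite dpoly_cat -Mh -!(HL _).2 subrK.
have /choice[c Hc] (l : R) : exists z, Lam l -> forall e : R, 0 < e ->
    exists N, forall n, (N <= n)%N -> cabs (q n l - z) <= e.
  (* Outside [Lam], where the weight has no lower bound, the value 0 is taken by default. *)
  have [Ll|nL] := pselect (Lam l); last by exists 0.
  have [z Hz] : exists z, forall e : R, 0 < e ->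
      exists N, forall n, (N <= n)%N -> cabs (q n l - z) <= e.
    apply: cabs_cauchy_lim => e /qC[N HN]; exists N => n m Nn Nm.
    have fl : fin_sub [:: l] by split => // x; rewrite inE => /eqP ->.
    have := HN n m Nn Nm _ fl; rewrite big_seq1; apply: le_trans.
    by rewrite ler_peMr ?cabs_ge0// w_ge1.
  by exists z.
have clim X e : fin_sub X -> 0 < e -> exists N, forall n, (N <= n)%N ->
    \sum_(l <- X) cabs (q n l - c l) * w l <= e.
  move=> [_]; elim: X e => [|l X IH] e XL e0.
    by exists 0%N => n _; rewrite big_nil ltW.
  have Ll : Lam l by apply: XL; rewrite mem_head.
  have wl0 : 0 < w l by apply: lt_le_trans (w_ge1 Ll).
  have e20 : 0 < e / 2 by rewrite divr_gt0.
  have [|N HN] := IH _ _ e20; first by move=> x xX; apply: XL; rewrite inE xX orbT.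
  have [M HM] := Hc l Ll _ (divr_gt0 e20 wl0).
  exists (maxn N M) => n; rewrite geq_max => /andP[/HN a /HM b]; rewrite big_cons.
  by rewrite ler_pdivlMr// in b; lra.
have qlim e : 0 < e -> exists N, forall n, (N <= n)%N -> forall X, fin_sub X ->
    \sum_(l <- X) cabs (q n l - c l) * w l <= e.
  (* The index M depends on X and r but drops out of the bound, so N stays uniform in X. *)
  move=> /qC[N HN]; exists N => n Nn X fX; apply/ler_addgt0Pr => r r0.
  have [M HM] := clim _ _ fX r0.
  have h1 := HN n (maxn N M) Nn (leq_maxl _ _) X fX.
  have h2 := HM _ (leq_maxr N M).
  apply: le_trans (lerD h1 h2); rewrite -big_split big_seq [leRHS]big_seq /=.
  apply: ler_sum => l lX; rewrite -mulrDl ler_wpM2r ?cabs_dist_triangle//.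
  by apply: w_ge0; case: fX => _; apply.
have [N HN] := qlim 1 ltr01.
exists c, (1 + \sum_(p <- L N) cabs p.2 * w p.1); split.
  move=> X fX; have [uX XL] := fX.
  have h1 := HN N (leqnn _) X fX.
  have h2 := sum_coef_le w_ge0 (HL N).1 uX.
  apply: le_trans (lerD h1 h2); rewrite -big_split big_seq [leRHS]big_seq /=.
  apply: ler_sum => l lX; rewrite -mulrDl ler_wpM2r ?w_ge0//; first exact: XL.
  by have := cabsB (q N l) (q N l - c l); rewrite opprB addrCA subrr addr0 addrC.
move=> s sH e e0; have e20 : 0 < e / 2 by rewrite divr_gt0.
have [M HM] := qlim _ e20; have [M' HM'] := Qh s sH _ e20.
pose n := maxn M M'.
have h1 := HM n (leq_maxl _ _); have h2 := HM' n (leq_maxr _ _).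
(* Once X contains all exponents of [L n], Q n s is exactly a sum over X and only coefficients are
   compared. *)
exists (undup [seq p.1 | p <- L n]).
  split; first exact: undup_uniq.
  by move=> l; rewrite mem_undup => /mapP[p /(HL n).1 ? ->].
move=> X [uX XL] X0X.
have Qn : Q n s = \sum_(l <- X) q n l * cexpn l s.
  rewrite (HL n).2; apply: dpoly_coef => // p pL; apply: X0X.
  by rewrite mem_undup map_f.
set x := \sum_(l <- X) _.
have h3 : cabs (Q n s - x) <= e / 2.
  rewrite Qn -sumrB; apply: le_trans (h1 X (conj uX XL)).
  under eq_bigr do rewrite -mulrBl.
  exact: (cabs_sum_le_weighted (fun l => q n l - c l)).
have -> : x - h s = (Q n s - h s) - (Q n s - x) by ring.
by apply: le_trans (cabsB _ _) _; lra.
Qed.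

End ScalarSums.

(** * The bicomplex norm and matrix entries *)

Section BicomplexNorm.
Variable R : realType.
Local Notation C := (R[i]).

Lemma cabs_le_vnorm2 d (v : 'cV[C]_d) i : cabs (v i ord0) <= vnorm2 v.
Proof.
rewrite /vnorm2 -[leLHS]ger0_norm ?cabs_ge0// -sqrtr_sqr ler_wsqrtr//.
by rewrite (bigD1 i) //= lerDl sumr_ge0// => j _; exact: sqr_ge0.
Qed.

Lemma vnorm2_le_sum d (v : 'cV[C]_d) : vnorm2 v <= \sum_i cabs (v i ord0).
Proof.
have s0 : 0 <= \sum_i cabs (v i ord0) by rewrite sumr_ge0// => i _; exact: cabs_ge0.
rewrite -[leRHS]ger0_norm// -sqrtr_sqr ler_wsqrtr// [leRHS]expr2 mulr_sumr.
apply: ler_sum => i _; rewrite expr2 ler_wpM2r ?cabs_ge0//.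
by rewrite (bigD1 i) //= lerDl sumr_ge0// => j _; exact: cabs_ge0.
Qed.

Lemma vnorm2_mulmx_le d (M : 'M[C]_d) (v : 'cV[C]_d) : vnorm2 v = 1 ->
  vnorm2 (M *m v) <= \sum_i \sum_j cabs (M i j).
Proof.
move=> v1; apply: le_trans (vnorm2_le_sum _) _; apply: ler_sum => i _.
rewrite mxE; apply: le_trans (cabs_sum _ _ _) _; apply: ler_sum => j _.
rewrite cabsM ler_piMr ?cabs_ge0// -v1; exact: cabs_le_vnorm2.
Qed.

(** Together with [cabs_le_opnorm] it lets every norm statement be read entrywise. *)
Lemma opnorm_le d (M : 'M[C]_d) : opnorm M <= \sum_i \sum_j cabs (M i j).
Proof.
rewrite /opnorm; set A := (X in sup X).
(* For d = 0 there is no unit vector, and [sup] of the empty set is 0. *)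
have [->|/set0P A0] := eqVneq A set0.
  by rewrite sup0 sumr_ge0// => i _; rewrite sumr_ge0// => j _; exact: cabs_ge0.
by apply: ge_sup => // _ [v [v1 ->]]; exact: vnorm2_mulmx_le.
Qed.

Lemma cabs_le_opnorm d (M : 'M[C]_d) i j : cabs (M i j) <= opnorm M.
Proof.
pose v : 'cV[C]_d := delta_mx j ord0.
have vE k : v k ord0 = (k == j)%:R by rewrite mxE eqxx andbT.
have v1 : vnorm2 v = 1.
  rewrite /vnorm2 (bigD1 j) //= big1 => [|k kj].
    by rewrite vE eqxx cabs1 expr1n addr0 sqrtr1.
  by rewrite vE (negPf kj) cabs0 expr0n.
apply: (@le_trans _ _ (vnorm2 (M *m v))).
  have -> : M i j = (M *m v) i ord0 by rewrite -colE mxE.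
  exact: cabs_le_vnorm2.
apply: ub_le_sup; last by exists v.
by exists (\sum_i \sum_j cabs (M i j)) => _ [u [u1 ->]]; exact: vnorm2_mulmx_le.
Qed.

(** A boolean index for the idempotent components, so that all entries are indexed by the one finite
    type [bool * 'I_d * 'I_d]. *)
Definition bcpart d (b : bool) (M : bcmat R d) : 'M[C]_d := if b then bc1 M else bc2 M.

Lemma bcpart_mul d b (M N : bcmat R d) :
  bcpart b (bcmul M N) = bcpart b M *m bcpart b N.
Proof. by case: b. Qed.

Lemma bcpart_one d b : bcpart b (bcone R d) = 1%:M.
Proof. by case: b. Qed.

Lemma bcpart_sub d b (M N : bcmat R d) i j :
  bcpart b (bcsub M N) i j = bcpart b M i j - bcpart b N i j.
Proof. by case: b; rewrite !mxE. Qed.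

Lemma bcpart_scale d b z (M : bcmat R d) i j :
  bcpart b (bcscale z M) i j = z * bcpart b M i j.
Proof. by case: b; rewrite mxE. Qed.

Lemma opnorm_ge0 d (M : 'M[C]_d) : 0 <= opnorm M.
Proof.
case: d M => [|d] M; last exact: le_trans (cabs_ge0 _) (cabs_le_opnorm M ord0 ord0).
rewrite /opnorm; set A := (X in sup X).
suff -> : A = set0 by rewrite sup0.
rewrite -subset0 => x [v [+ _]].
by rewrite /vnorm2 big_ord0 sqrtr0 => /esym/eqP; rewrite oner_eq0.
Qed.

Lemma bcnorm_ge0 d (M : bcmat R d) : 0 <= bcnorm M.
Proof. by rewrite addr_ge0// opnorm_ge0. Qed.

Lemma cabs_le_bcnorm d (M : bcmat R d) b i j : cabs (bcpart b M i j) <= bcnorm M.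
Proof.
rewrite /bcnorm; case: b => /=; apply: le_trans (cabs_le_opnorm _ _ _) _.
  by rewrite lerDl opnorm_ge0.
by rewrite lerDr opnorm_ge0.
Qed.

Lemma bcnorm_le d (M : bcmat R d) :
  bcnorm M <= \sum_(p : bool * 'I_d * 'I_d) cabs (bcpart p.1.1 M p.1.2 p.2).
Proof.
rewrite -(pair_bigA _ (fun a j => cabs (bcpart a.1 M a.2 j))) /=.
rewrite -(pair_bigA _ (fun b i => \sum_j cabs (bcpart b M i j))) /=.
by rewrite big_bool /=; apply: lerD; exact: opnorm_le.
Qed.

Lemma bc_invertible_det d (M : bcmat R d) :
  bc_invertible M <-> forall b, \det (bcpart b M) != 0.
Proof.
split.
  move=> [N [MN _]] b; have h : bcpart b M *m bcpart b N = 1%:M.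
    by rewrite -bcpart_mul MN bcpart_one.
  by apply/eqP => d0; move: (congr1 determinant h);
    rewrite det_mulmx d0 mul0r det1 => /esym/eqP; rewrite oner_eq0.
move=> h; have h1 := h true; have h2 := h false.
exists (BCMat (invmx (bc1 M)) (invmx (bc2 M))); rewrite /bcmul /bcone /=.
by rewrite !mulmxV ?mulVmx// unitmxE unitfE.
Qed.

End BicomplexNorm.

Lemma invmx_entry (K : comUnitRingType) d (A : 'M[K]_d) i j : A \in unitmx ->
  invmx A i j = (\det A)^-1 * (\adj A) i j.
Proof. by move=> uA; rewrite /invmx uA mxE. Qed.

(** * Bicomplex Dirichlet series and the closure of their range *)

Section BicomplexDirichlet.
Variables (R : realType) (d : nat).
Local Notation C := (R[i]).
Variables (Lam : set R) (w : R -> R).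
Hypothesis mLam : submonoid Lam.
Hypothesis adm : admissible_weight Lam w.

Lemma fin_subP (X : seq R) : fin_sub Lam X -> finite_set [set` X] /\ [set` X] `<=` Lam.
Proof. by move=> [_ XL]; split => // l /= /XL. Qed.

Lemma finite_sub_seq (X : set R) : finite_set X -> X `<=` Lam ->
  exists2 Y, fin_sub Lam Y & X = [set` Y].
Proof.
move=> /finite_seqP[Y ->] YL; exists (undup Y).
  by split; [exact: undup_uniq|move=> l; rewrite mem_undup => /YL].
by apply/seteqP; split => l /=; rewrite mem_undup.
Qed.

Lemma bcpart_fsum b (X : seq R) (G : R -> bcmat R d) i j : uniq X ->
  bcpart b (bcfsum [set` X] G) i j = \sum_(l <- X) bcpart b (G l) i j.
Proof.
by move=> uX; case: b; rewrite /bcpart /bcfsum /= -fsbig_seq// summxE.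
Qed.

Lemma inD_Dlim (f : C -> bcmat R d) b i j : inD Lam w f ->
  Dlim Lam w (fun s => bcpart b (f s) i j).
Proof.
move=> [F [Fsum Ff]].
have w0 l : Lam l -> 0 <= w l.
  by case: adm => -[w1 _ _] _ /w1; apply: le_trans.
pose S := (\esum_(l in Lam) ((bcnorm (F l) * w l)%:E))%E.
have S0 : (0 <= S)%E.
  by apply: esum_ge0 => l Ll; rewrite lee_fin mulr_ge0 ?bcnorm_ge0 ?w0.
have Sfin : S \is a fin_num by rewrite ge0_fin_numE.
apply: (@Dlim_of_scalar_sum _ _ _ mLam adm (fun l => bcpart b (F l) i j) (fine S)).
  move=> X fX; rewrite -lee_fin fineK//.
  apply: (@le_trans _ _ (\sum_(l <- X) bcnorm (F l) * w l)%:E).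
    rewrite lee_fin big_seq [leRHS]big_seq; apply: ler_sum => l lX.
    by rewrite ler_wpM2r ?cabs_le_bcnorm// w0//; case: fX => _; apply.
  apply: esum_ge; exists [set` X]; first exact: fin_subP.
  by rewrite -fsbig_seq; [rewrite sumEFin|case: fX].
move=> s sH e e0; have [X0 [fX0 X0L HX0]] := Ff s sH e e0.
have [Y fY X0Y] := finite_sub_seq fX0 X0L.
exists Y => // X fX YX; have [fX' XL] := fin_subP fX.
have YX' : X0 `<=` [set` X] by rewrite X0Y => l /= /YX.
have := HX0 _ fX' YX' XL; move=> /ltW; apply: le_trans.
apply: le_trans (cabs_le_bcnorm _ b i j).
rewrite le_eqVlt; apply/orP; left; apply/eqP; congr cabs.
rewrite bcpart_sub bcpart_fsum; last by case: fX.
congr (_ - _); apply: eq_bigr => l _.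
by rewrite bcpart_scale mulrC.
Qed.

Lemma Dlim_inD (g : C -> bcmat R d) :
  (forall b i j, Dlim Lam w (fun s => bcpart b (g s) i j)) -> inD Lam w g.
Proof.
move=> Dg; pose I := (bool * 'I_d * 'I_d)%type.
have w0 l : Lam l -> 0 <= w l.
  by case: adm => -[w1 _ _] _ /w1; apply: le_trans.
have /choice[cB HcB] (p : I) : exists cB : (R -> C) * R,
    abs_sum_le Lam w cB.1 cB.2 /\ forall s, inH s ->
    scalar_sum Lam cB.1 s (bcpart p.1.1 (g s) p.1.2 p.2).
  by have [c [B ?]] := scalar_sum_of_Dlim mLam adm (Dg p.1.1 p.1.2 p.2); exists (c, B).
pose c b i j := (cB (b, i, j)).1.
pose F l := BCMat (\matrix_(i, j) c true i j l) (\matrix_(i, j) c false i j l).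
have FE b i j l : bcpart b (F l) i j = c b i j l by case: b; rewrite mxE.
exists F; split.
  apply: (@le_lt_trans _ _ (\sum_p (cB p).2)%:E); last exact: ltry.
  apply: ge_ereal_sup => _ [A [fA AL] <-].
  have [X fX ->] := finite_sub_seq fA AL; have [uX XL] := fX.
  rewrite -fsbig_seq// sumEFin lee_fin.
  apply: (@le_trans _ _ (\sum_(l <- X) \sum_p cabs ((cB p).1 l) * w l)).
    rewrite big_seq [leRHS]big_seq; apply: ler_sum => l /XL/w0 wl.
    rewrite -mulr_suml ler_wpM2r//; apply: le_trans (bcnorm_le _) _.
    by apply: ler_sum => -[[b i] j] _; rewrite FE.
  by rewrite exchange_big /=; apply: ler_sum => p _; exact: (HcB p).1.
move=> s sH e e0.
(* The added 1 makes the final inequality strict and K positive even for d = 0. *)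
pose K : R := #|{: I}|%:R + 1.
have K0 : 0 < K by rewrite ltr_wpDl.
have eK : 0 < e / K by rewrite divr_gt0.
have /choice[X0 HX0] (p : I) : exists Y, fin_sub Lam Y /\
    forall X, fin_sub Lam X -> {subset Y <= X} ->
    cabs (\sum_(l <- X) (cB p).1 l * cexpn l s - bcpart p.1.1 (g s) p.1.2 p.2) <= e / K.
  by have [Y ? ?] := (HcB p).2 s sH _ eK; exists Y.
(* One finite set beyond which every entry is within e / K. *)
pose Y := flatten [seq X0 p | p <- enum {: I}].
exists [set` Y]; split; first exact: finite_seq.
  by move=> l /= /flattenP[_ /mapP[p _ ->]]; case: (HX0 p) => -[_ + _]; apply.
move=> A fA YA AL; have [X fX AX] := finite_sub_seq fA AL; have [uX XL] := fX.
rewrite AX; apply: le_lt_trans (bcnorm_le _) _.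
apply: (@le_lt_trans _ _ (\sum_(p : I) e / K)).
  apply: ler_sum => -[[b i] j] _ /=.
  have pX : {subset X0 (b, i, j) <= X}.
    move=> l lX; have : [set` Y] l.
      by apply/flattenP; exists (X0 (b, i, j)) => //; rewrite map_f// mem_enum.
    by move=> /YA; rewrite AX.
  apply: le_trans ((HX0 (b, i, j)).2 X fX pX).
  rewrite le_eqVlt; apply/orP; left; apply/eqP; congr cabs.
  rewrite bcpart_sub bcpart_fsum//=; congr (_ - _); apply: eq_bigr => l _.
  by rewrite -/(c b i j l) -FE bcpart_scale mulrC.
rewrite sumr_const -mulr_natl mulrA ltr_pdivrMr// mulrC ltr_pM2l//.
by rewrite /K ltrDl.
Qed.

(** det f det g = 1 with det g bounded on [inH] keeps det f away from 0, and continuity of the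
    determinant carries this to the closure. *)
Lemma invertible_in_D_closure (f : C -> bcmat R d) :
  inD Lam w f -> invertible_in_D Lam w f -> range_closure_in_GL f.
Proof.
move=> fD [g [gD fg]] M HM; apply/bc_invertible_det => b.
have [B [B0 HB]] := Dlim_bounded mLam adm
  (Dlim_det mLam adm (fun i j => inD_Dlim b i j gD)).
have inv0 n : 0 < (n.+1%:R : R)^-1 by rewrite invr_gt0.
have [u Hu] := choice (fun n => HM _ (inv0 n)).
have FF : Filter (\oo : set_system nat) by exact: filter_filter.
have cM i j : clim \oo (fun n => bcpart b (f (u n)) i j) (bcpart b M i j).
  move=> e /invS_small[N HN]; exists N => // n /= /HN h.
  apply: le_trans h; apply: le_trans (ltW (Hu n).2).
  by apply: le_trans (cabs_le_bcnorm _ b i j); rewrite bcpart_sub.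
(* At this size |det f| |det g| <= B / (2 (B + 1)) < 1. *)
apply/eqP => d0; have B10 : 0 < (B + 1)^-1 / 2 by rewrite divr_gt0// invr_gt0; lra.
have [N _ HN] := clim_det FF cM B10.
have := HN N (leqnn _); rewrite /= d0 subr0 => h.
have := HB (u N) (Hu N).1 => h'.
have prod1 : bcpart b (f (u N)) *m bcpart b (g (u N)) = 1%:M.
  by rewrite -bcpart_mul (fg _ (Hu N).1).1 bcpart_one.
move: (congr1 (fun A => cabs (\det A)) prod1); rewrite det_mulmx det1 cabsM cabs1 => e1.
have := ler_pM (cabs_ge0 _) (cabs_ge0 _) h h'; rewrite e1.
have : (B + 1)^-1 * (B + 1) = 1 by rewrite mulVf// gt_eqF//; lra.
move: B10; set t := (B + 1)^-1; nra.
Qed.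

(* Compactness of bounded sets of matrices, through an ultrafilter limit taken
   in all entries of both components at once. *)
Lemma closure_det_bounded_below (f : C -> bcmat R d) b :
  inD Lam w f -> range_closure_in_GL f ->
  exists delta, 0 < delta /\ forall s, inH s -> delta <= cabs (\det (bcpart b (f s))).
Proof.
move=> fD fGL; apply: contrapT => nd.
have inv0 n : 0 < (n.+1%:R : R)^-1 by rewrite invr_gt0.
have small n : exists s, inH s /\ cabs (\det (bcpart b (f s))) < n.+1%:R^-1.
  apply: contrapT => ns; apply: nd; exists n.+1%:R^-1; split => // s sH.
  by rewrite leNgt; apply/negP => h; apply: ns; exists s.
have [u Hu] := choice small.
(* Being finer than [\oo], U still sends 1 / (n + 1) to 0; the limit matrix A then lies in the
   closure and has determinant 0, against [fGL]. *)
have [U [UU oU]] := @ultraFilterLemma nat \oo _.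
have FU : Filter U by exact: filter_filter.
have /choice[M HM] (p : bool * 'I_d * 'I_d) :
    exists z, clim U (fun n => bcpart p.1.1 (f (u n)) p.1.2 p.2) z.
  have [B [B0 HB]] := Dlim_bounded mLam adm (inD_Dlim p.1.1 p.1.2 p.2 fD).
  by apply: (ultra_clim UU) => n; apply: HB; case: (Hu n).
pose A := BCMat (\matrix_(i, j) M (true, i, j)) (\matrix_(i, j) M (false, i, j)).
have AE c i j : bcpart c A i j = M (c, i, j) by case: c; rewrite mxE.
have Ainv : bc_invertible A.
  apply: fGL => e e0.
  pose I := (bool * 'I_d * 'I_d)%type; pose K : R := #|{: I}|%:R + 1.
  have K0 : 0 < K by rewrite ltr_wpDl.
  have eK : 0 < e / K by rewrite divr_gt0.
  have : U [set n | forall p : I, cabs (bcpart p.1.1 (f (u n)) p.1.2 p.2 - M p) <= e / K].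
    by apply: filter_forall => p; exact: HM.
  move=> /filter_ex[n Hn]; exists (u n); split; first by case: (Hu n).
  apply: le_lt_trans (bcnorm_le _) _.
  apply: (@le_lt_trans _ _ (\sum_(p : I) e / K)).
    apply: ler_sum => -[[c i] j] _ /=; apply: le_trans (Hn (c, i, j)).
    by rewrite bcpart_sub AE.
  rewrite sumr_const -mulr_natl mulrA ltr_pdivrMr// mulrC ltr_pM2l//.
  by rewrite /K ltrDl.
have /bc_invertible_det/(_ b)/eqP := Ainv; apply.
apply: cabs_eq0; apply/eqP; rewrite eq_le cabs_ge0 andbT.
apply/ler_addgt0Pr => e e0; rewrite add0r.
have e20 : 0 < e / 2 by rewrite divr_gt0.
have cA i j : clim U (fun n => bcpart b (f (u n)) i j) (bcpart b A i j).
  by rewrite AE; exact: (HM (b, i, j)).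
have h1 := clim_det FU cA e20.
have h2 : U [set n | (n.+1%:R : R)^-1 <= e / 2].
  by apply: oU; have [N HN] := invS_small e20; exists N.
have /filter_ex[n [/= n1 n2]] := @filterI _ U FU _ _ h1 h2.
have {n2} n3 := lt_le_trans (Hu n).2 n2.
have := cabsB (\det (bcpart b (f (u n)))) (\det (bcpart b (f (u n))) - \det (bcpart b A)).
rewrite opprB addrCA subrr addr0; lra.
Qed.

(** Cramer's rule: the entries of the inverse are adjugate entries divided by a determinant bounded
    below, so [Dlim_inv] and the ring operations of [Dlim] suffice. *)
Lemma closure_invertible_in_D (f : C -> bcmat R d) :
  inD Lam w f -> range_closure_in_GL f -> invertible_in_D Lam w f.
Proof.
move=> fD fGL.
have unit_f b s : inH s -> bcpart b (f s) \in unitmx.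
  have [delta [d0 Hd]] := closure_det_bounded_below b fD fGL.
  move=> /Hd h; rewrite unitmxE unitfE; apply/eqP => e; move: h.
  by rewrite e cabs0 leNgt d0.
exists (fun s => BCMat (invmx (bc1 (f s))) (invmx (bc2 (f s)))); split.
  apply: Dlim_inD => b i j.
  have [delta [d0 Hd]] := closure_det_bounded_below b fD fGL.
  have Df := fun i j => inD_Dlim b i j fD.
  apply: (@Dlim_ext _ _ _ (fun s => (\det (bcpart b (f s)))^-1 * (\adj (bcpart b (f s))) i j)).
    move=> s sH; have := unit_f b s sH.
    by case: b {Df Hd} => u; rewrite [RHS]invmx_entry.
  apply: DlimM => //; last exact: Dlim_adj.
  exact: Dlim_inv (Dlim_det mLam adm Df) d0 Hd.
move=> s sH; have u1 := unit_f true s sH; have u2 := unit_f false s sH.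
by rewrite /bcmul /bcone /= !mulmxV ?mulVmx.
Qed.

End BicomplexDirichlet.

Theorem mainTheorem7 (R : realType) (d : nat) (Lam : set R) (w : R -> R)
  (HLam_nonneg : forall l, Lam l -> 0 <= l)
  (HLam0 : Lam 0)
  (HLam_add : forall a b, Lam a -> Lam b -> Lam (a + b))
  (Hw : admissible_weight Lam w)
  (f : R[i] -> bcmat R d) (Hf : inD Lam w f) :
  invertible_in_D Lam w f <-> range_closure_in_GL f.
Proof.
have mLam : submonoid Lam by split.
by split; [exact: invertible_in_D_closure|exact: closure_invertible_in_D].
Qed.
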